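(* Let $C\ge1$, and for $1\le i\le C$ let $N_i\in\{1,2,\dots\}\cup\{\infty\}$ and let $\mathcal{S}_i$ be a Polish space. For each $r\in\mathbb{R}_+\cup\{\infty\}$ let $(X^r_{n,i})_{1\le n\le N_i,\,1\le i\le C}$ be a multi-exchangeable system, $X^r_{n,i}$ taking values in $\mathcal{S}_i$, with measure vector $(\Lambda_i^{N_i,r})_{1\le i\le C}$ (defined below). Then, as $r\to\infty$ through $\mathbb{R}_+$, \[ (X^r_{n,i})_{1\le n\le N_i,\,1\le i\le C}\longrightarrow (X^\infty_{n,i})_{1\le n\le N_i,\,1\le i\le C}\quad\text{in law} \] (in the product space $\prod_{i=1}^C\mathcal{S}_i^{N_i}$ with the product topology) if and only if \[ (\Lambda_i^{N_i,r})_{1\le i\le C}\longrightarrow(\Lambda_i^{N_i,\infty})_{1\le i\le C}\quad\text{in law} \] (in $\mathcal{P}(\mathcal{S}_1)\times\cdots\times\mathcal{P}(\mathcal{S}_C)$ with the weak topologies).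
   Context: For $k\ge1$, $\Sigma(k)$ is the set of permutations of $\{1,\dots,k\}$ and $\Sigma(\infty)$ is the set of permutations of $\{1,2,\dots\}$ with finite support; $1\le n\le\infty$ means $n\ge1$. A system $(X_{n,i})_{1\le n\le N_i,\,1\le i\le C}$ of random variables, $X_{n,i}$ with values in $\mathcal{S}_i$, is multi-exchangeable if $\mathcal{L}\big((X_{\sigma_i(n),i})_{1\le n\le N_i,1\le i\le C}\big)=\mathcal{L}\big((X_{n,i})_{1\le n\le N_i,1\le i\le C}\big)$ for all $\sigma_i\in\Sigma(N_i)$, $1\le i\le C$. In particular each class $(X_{n,i})_{n}$ is exchangeable; if $N_i=\infty$, by de Finetti's theorem the limit $\Lambda_i^\infty=\lim_{N\to\infty}\frac1N\sum_{n=1}^N\delta_{X_{n,i}}$ exists a.s. in the weak topology of $\mathcal{P}(\mathcal{S}_i)$ (the directing measure). The measure vector of the system is $(\Lambda_i^{N_i})_{1\le i\le C}$ with values in $\mathcal{P}(\mathcal{S}_1)\times\cdots\times\mathcal{P}(\mathcal{S}_C)$, where $\Lambda_i^{N_i}=\frac1{N_i}\sum_{n=1}^{N_i}\delta_{X_{n,i}}$ (empirical measure) if $N_i<\infty$ and $\Lambda_i^{N_i}=\Lambda_i^\infty$ (directing measure) if $N_i=\infty$; for the system indexed by $r$ this vector is denoted $(\Lambda_i^{N_i,r})_{1\le i\le C}$. Spaces of probability measures carry the weak topology. *)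

(* Defs.v *)
From HB Require Import structures.
From mathcomp Require Import all_boot all_order all_algebra.
From mathcomp Require Import all_classical all_reals all_analysis.

Set Implicit Arguments.
Unset Strict Implicit.
Unset Printing Implicit Defensive.

Import Order.TTheory GRing.Theory Num.Theory.
Import numFieldNormedType.Exports.

Local Open Scope classical_set_scope.
Local Open Scope ring_scope.

Definition polish (R : realType) (T : topologicalType) : Prop :=
  (exists D : set T, countable D /\ closure D = setT) /\
  exists dist : T -> T -> R,
    [/\ (forall x y, 0 <= dist x y),
        (forall x y, dist x y = 0 <-> x = y),
        (forall x y, dist x y = dist y x) &
        (forall x y z, dist x z <= dist x y + dist y z)] /\
    (
        (forall (x : T) (A : set T),
            nbhs x A <-> exists e : R, 0 < e /\ [set y | dist x y < e] `<=` A) /\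
        (forall u : nat -> T,
            (forall e : R, 0 < e -> exists M : nat, forall m n : nat,
                (M <= m)%N -> (M <= n)%N -> dist (u m) (u n) < e) ->
            exists l : T, u @ \oo --> l)).

Definition borel (T : topologicalType) : set (set T) := <<s @open T >>.

(* The Borel measurable space of T (needs T pointed, i.e. nonempty). *)
Notation borelType T := (g_sigma_algebraType (@open T)).

Notation Prob R T := (probability (borelType T) R).

Definition bcfun (R : realType) (T : topologicalType) :=
  {f : T -> R | continuous f /\ exists M : R, forall x, `|f x| <= M}.

Definition integ_map (R : realType) (T : ptopologicalType)
  (mu : Prob R T) : prod_topology (fun _ : bcfun R T => R) :=
  fun f => (\int[mu]_x (proj1_sig f x))%R.

Notation weakP R T :=
  (@initial_topology _ (prod_topology (fun _ : bcfun R T => R)) (@integ_map R T)).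

(* N_i is [Some m] (the finite value m >= 1) or [None] (= infinity). *)
Definition inI (k : option nat) (n : nat) : bool :=
  (0 < n)%N && (if k is Some m then (n <= m)%N else true).

Definition sys_space (C : nat) (N : 'I_C -> option nat)
  (S : 'I_C -> ptopologicalType) : topologicalType :=
  prod_topology (fun i : 'I_C =>
    (prod_topology (fun _ : {n : nat | inI (N i) n} => S i) : topologicalType)).

(* s restricted to {1..k} (resp. {1,2,...}) is an element of Sigma(k)
   (resp. Sigma(infinity): finitely supported permutations). *)
Definition is_perm_of (k : option nat) (s : nat -> nat) : Prop :=
  [/\ (forall n, inI k n -> inI k (s n)),
      (forall n m, inI k n -> inI k m -> s n = s m -> n = m),
      (forall m, inI k m -> exists n, inI k n /\ s n = m) &
      exists M : nat, forall n, (M < n)%N -> s n = n].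

Definition cyl (C : nat) (N : 'I_C -> option nat)
  (S : 'I_C -> ptopologicalType) : set (set (sys_space N S)) :=
  fun A => exists (i : 'I_C) (k : {n : nat | inI (N i) n}) (B : set (S i)),
      borel B /\ A = [set x | B (x i k)].

Section Systems.
Context (R : realType) (C : nat) (N : 'I_C -> option nat)
  (S : 'I_C -> ptopologicalType).
Context {d : measure_display} (Om : measurableType d) (P : probability Om R).

Definition sys (X : forall i : 'I_C, nat -> Om -> S i) (w : Om)
  : sys_space N S := fun i k => X i (proj1_sig k) w.

Definition is_system (X : forall i : 'I_C, nat -> Om -> S i) : Prop :=
  forall i n, inI (N i) n ->
    forall B : set (S i), borel B -> measurable (X i n @^-1` B).

Definition multi_exchangeable (X : forall i : 'I_C, nat -> Om -> S i) : Prop :=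
  forall sigma : forall i : 'I_C, nat -> nat,
    (forall i, is_perm_of (N i) (sigma i)) ->
    forall A : set (sys_space N S), <<s @cyl C N S >> A ->
      P [set w | A (fun i k => X i (sigma i (proj1_sig k)) w)] =
      P [set w | A (sys X w)].

Definition mvec_space : topologicalType := prod_topology (fun i : 'I_C => (weakP R (S i) : topologicalType)).

(* Lam is (a measurable version of) the measure vector of X:
   empirical measure if N_i is finite, directing measure
   (a.s. weak limit of empirical measures) if N_i is infinite. *)
Definition is_measure_vector (X : forall i : 'I_C, nat -> Om -> S i)
  (Lam : Om -> mvec_space) : Prop :=
  (forall B : set mvec_space, borel B -> measurable (Lam @^-1` B)) /\
  forall i : 'I_C,
    match N i with
    | Some m =>
        forall w (B : set (S i)), borel B ->
          (Lam w i : Prob R (S i)) B =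
            ((m%:R)^-1 * \sum_(1 <= n < m.+1) \1_B (X i n w))%:E
    | None =>
        {ae P, forall w, forall f : bcfun R (S i),
          (fun M : nat => (M%:R)^-1 * \sum_(1 <= n < M.+1) proj1_sig f (X i n w))
            @ \oo --> integ_map (Lam w i : Prob R (S i)) f}
    end.

End Systems.

(** * Convergence in law as r -> infinity, r in R_+ ; index [Some r] is
    the system number r, [None] is the system number infinity. *)
Definition cvg_in_law (R : realType) (T : topologicalType)
  (d : option R -> measure_display) (Om : forall r, measurableType (d r))
  (P : forall r, probability (Om r) R) (Y : forall r, Om r -> T) : Prop :=
  forall F : T -> R, continuous F -> (exists M : R, forall t, `|F t| <= M) ->
    (\int[P (Some r)]_w F (Y (Some r) w))%R @[r --> +oo]
      --> (\int[P None]_w F (Y None w))%R.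

Definition Rplus_oo (R : realType) (r : option R) : Prop :=
  if r is Some x then 0 <= x else True.

(* Main.v *)
Require Import Defs.
From HB Require Import structures.
From mathcomp Require Import all_boot all_order all_algebra.
From mathcomp Require Import all_classical all_reals all_analysis.
From mathcomp Require Import measurable_realfun ring lra.

(** Both laws are determined by moments: products of bounded continuous
    functions [f (X n i)] of coordinates on one side, products of integrals
    [\int f dLam_i] on the other.  These moments determine each other linearly,
    with coefficients that do not depend on [r]; for a coordinate [n] not
    occurring in the product [Z] (with [Psi] a product of integrals),
    - if [N i = oo], then [E (Z g(X n i) Psi) = E (Z (\int g dLam_i) Psi)], since
      the left-hand side does not depend on [n] and can be averaged over [n];
    - if [N i = m], then [\int g dLam_i] is the mean of the [g (X n i)], and the
      terms of this mean with [n] unused all contribute equally, while those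
      with [n] used have fewer distinct coordinates.
    So the convergence of all moments of one kind gives that of the other.

    Convergence of moments implies convergence in law without any tightness:
    both target spaces carry the initial topology of a countable family of
    functions, hence every nonnegative continuous function is the pointwise
    supremum of a countable family in the uniformly closed algebra generated by
    these functions, which gives
    [E F(Y oo) <= liminf E F(Y r)] for [F >= 0], and then for [M - F]. *)

Set Implicit Arguments.
Unset Strict Implicit.
Unset Printing Implicit Defensive.

Import Order.TTheory GRing.Theory Num.Theory.
Import numFieldNormedType.Exports.

Local Open Scope classical_set_scope.
Local Open Scope ring_scope.

(** * Bounded functions and expectations *)

Definition bounded_by_some (R : realType) (T : Type) (f : T -> R) : Prop :=
  exists M : R, forall x, `|f x| <= M.

Section BoundedFunctions.
Context (R : realType) (T : Type).
Implicit Types f g : T -> R.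

Lemma bddP f : bounded_by_some f ->
  exists M : R, 0 < M /\ forall x, `|f x| <= M.
Proof.
move=> [M fM]; exists (`|M| + 1); split; first by rewrite ltr_wpDl.
by move=> x; rewrite (le_trans (fM x))// (le_trans (ler_norm _))// lerDl.
Qed.

Lemma bdd_cst (c : R) : bounded_by_some (fun _ : T => c).
Proof. by exists `|c|. Qed.

Lemma bddD f g : bounded_by_some f -> bounded_by_some g ->
  bounded_by_some (fun x => f x + g x).
Proof.
move=> [M fM] [K gK]; exists (M + K) => x.
by rewrite (le_trans (ler_normD _ _))// lerD.
Qed.

Lemma bddM f g : bounded_by_some f -> bounded_by_some g ->
  bounded_by_some (fun x => f x * g x).
Proof.
move=> [M fM] [K gK]; exists (M * K) => x.
by rewrite normrM ler_pM.
Qed.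

Lemma bdd_unif f : (forall e : R, 0 < e ->
    exists2 g, bounded_by_some g & forall x, `|f x - g x| <= e) ->
  bounded_by_some f.
Proof.
move=> /(_ 1 ltr01)[g [M gM] fg]; exists (1 + M) => x.
rewrite -(subrK (g x) (f x)) (le_trans (ler_normD _ _))//.
by rewrite lerD.
Qed.

End BoundedFunctions.

Section Expectation.
Context (R : realType) (d : measure_display) (Om : measurableType d)
  (P : probability Om R).
Implicit Types f g : Om -> R.

Definition bm f : Prop := measurable_fun setT f /\ bounded_by_some f.

Lemma bm_integrable f : bm f -> P.-integrable setT (EFin \o f).
Proof.
move=> [mf [M fM]]; apply: measurable_bounded_integrable => //.
  by apply: le_lt_trans (probability_le1 P measurableT) _; rewrite ltry.
exists M; split; first exact: num_real.
by move=> K MK x _; apply: le_trans (fM x) _; exact: ltW.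
Qed.

Lemma bm_cst (c : R) : bm (fun=> c).
Proof. by split=> //; exact: bdd_cst. Qed.

Lemma bmD f g : bm f -> bm g -> bm (fun x => f x + g x).
Proof. by move=> [mf bf] [mg bg]; split; [exact: measurable_funD|exact: bddD]. Qed.

Lemma bmM f g : bm f -> bm g -> bm (fun x => f x * g x).
Proof. by move=> [mf bf] [mg bg]; split; [exact: measurable_funM|exact: bddM]. Qed.

Lemma bmZ (c : R) f : bm f -> bm (fun x => c * f x).
Proof. by move=> bf; apply: bmM => //; exact: bm_cst. Qed.

Lemma bm_sum (I : Type) (s : seq I) (F : I -> Om -> R) :
  (forall i, bm (F i)) -> bm (fun x => \sum_(i <- s) F i x).
Proof.
move=> bF; elim: s => [|i s IH].
  by under eq_fun do rewrite big_nil; exact: bm_cst.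
by under eq_fun do rewrite big_cons; exact: bmD.
Qed.

Local Notation E f := (\int[P]_w f w)%R.

Lemma Ex_cst (c : R) : E (fun=> c) = c.
Proof. by rewrite Rintegral_cst//= probability_setT mulr1. Qed.

Lemma ExD f g : bm f -> bm g -> E (fun x => f x + g x) = E f + E g.
Proof. by move=> bf bg; rewrite RintegralD//; exact: bm_integrable. Qed.

Lemma ExZ (c : R) f : bm f -> E (fun x => c * f x) = c * E f.
Proof. by move=> bf; rewrite RintegralZl//; exact: bm_integrable. Qed.

Lemma Ex_sum (I : Type) (s : seq I) (F : I -> Om -> R) :
  (forall i, bm (F i)) ->
  E (fun x => \sum_(i <- s) F i x) = \sum_(i <- s) E (F i).
Proof.
move=> bF; elim: s => [|i s IH].
  by under eq_Rintegral do rewrite big_nil; rewrite Ex_cst big_nil.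
under eq_Rintegral do rewrite big_cons.
by rewrite ExD ?big_cons ?IH//; exact: bm_sum.
Qed.

Lemma Ex_le f g : bm f -> bm g -> (forall x, f x <= g x) -> E f <= E g.
Proof. by move=> bf bg fg; apply: le_Rintegral => //; exact: bm_integrable. Qed.

Lemma Ex_dist f g (e : R) : bm f -> bm g -> (forall x, `|f x - g x| <= e) ->
  `|E f - E g| <= e.
Proof.
move=> bf bg fg; rewrite ler_norml; apply/andP; split.
  rewrite lerNl opprB lerBlDr -[in leRHS](Ex_cst e) -ExD//; last exact: bm_cst.
  apply: Ex_le => //; first by apply: bmD => //; exact: bm_cst.
  by move=> x; have := fg x; rewrite ler_norml => /andP[]; lra.
rewrite lerBlDr -[in leRHS](Ex_cst e) -ExD//; last exact: bm_cst.
apply: Ex_le => //; first by apply: bmD => //; exact: bm_cst.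
by move=> x; have := fg x; rewrite ler_norml => /andP[]; lra.
Qed.

Lemma Ex_bound f (M : R) : bm f -> (forall x, `|f x| <= M) -> `|E f| <= M.
Proof.
move=> bf fM; rewrite -[X in `|X|]subr0 -(Ex_cst 0).
by apply: Ex_dist => //; [exact: bm_cst|move=> x; rewrite subr0].
Qed.

(** Dominated convergence with a constant majorant, integrable since [P] has mass one. *)
Lemma Ex_dct (f_ : nat -> Om -> R) f (M : R) :
  (forall n, measurable_fun setT (f_ n)) -> measurable_fun setT f ->
  (forall n x, `|f_ n x| <= M) ->
  {ae P, forall x, f_ ^~ x @ \oo --> f x} ->
  (fun n => E (f_ n)) @ \oo --> E f.
Proof.
move=> mf_ mf f_M f_f.
have ic : P.-integrable setT (cst M%:E).
  by rewrite (_ : cst _ = EFin \o cst M)//; apply: bm_integrable; exact: bm_cst.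
have [||||] := @dominated_convergence _ _ _ P setT measurableT
   (fun n => EFin \o f_ n) (EFin \o f) (cst M%:E) _ _ _ ic.
- by move=> n; exact/measurable_EFinP.
- exact/measurable_EFinP.
- apply: filterS f_f => x fx _.
  by apply/cvg_EFin => //; exact: nearW.
- by apply: aeW => x n _ /=; rewrite lee_fin.
move=> fi _ h; apply: fine_cvg; rewrite fineK//.
exact: integrable_fin_num.
Qed.

End Expectation.

(** * Uniformly closed algebras and approximation from below *)

Section UniformAlgebra.
Context (R : realType) (T : Type).

Record uniform_algebra (A : (T -> R) -> Prop) : Prop := UniformAlgebra {
  ua_bdd : forall f, A f -> bounded_by_some f;
  ua_cst : forall c, A (fun=> c);
  ua_add : forall f g, A f -> A g -> A (fun x => f x + g x);
  ua_mul : forall f g, A f -> A g -> A (fun x => f x * g x);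
  ua_unif : forall f, (forall e : R, 0 < e ->
    exists2 g, A g & forall x, `|f x - g x| <= e) -> A f }.

(* Newton-like iteration [p -> p + (g^2 - p^2) / 2], increasing to [|g|]. *)
Fixpoint abs_approx (g : T -> R) (n : nat) (x : T) : R :=
  if n is m.+1 then
    abs_approx g m x + 2^-1 * (g x * g x + -1 * (abs_approx g m x * abs_approx g m x))
  else 0.

(** Put t = |g x|, p the current approximation and e = t - p. One iteration replaces e by e (1 - (t
    + p) / 2), which is at most e (1 - e / 2) because p >= 0; the rate 2 / (n + 2) follows by
    induction. *)
Lemma abs_approx_error (g : T -> R) x n : `|g x| <= 1 ->
  0 <= `|g x| - abs_approx g n x <= `|g x| /\
  `|g x| - abs_approx g n x <= 2 / n.+2%:R.
Proof.
move=> g1; elim: n => [|n [/andP[IH0 IH1] IH2]] /=.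
  by rewrite subr0 normr_ge0 lexx divff.
have g2 : g x * g x = `|g x| * `|g x| by rewrite -!expr2 real_normK ?num_real.
rewrite g2; move: IH0 IH1 IH2 (normr_ge0 (g x)) g1.
move: `|g x| (abs_approx g n x) => t p IH0 IH1 IH2 t0 t1.
have n2 : 0 < n.+2%:R :> R by [].
have n3 : 0 < n.+3%:R :> R by [].
split; first by apply/andP; split; nra.
have e1 : t - (p + 2^-1 * (t * t + -1 * (p * p))) <= (t - p) * (1 - (t - p) / 2).
  by nra.
apply: (le_trans e1).
have [e0 E0] : exists e0 : R, e0 = t - p by exists (t - p).
have [u U] : exists u : R, u = 2 / n.+2%:R by eexists.
have u1 : u <= 1 by rewrite U ler_pdivrMr// mul1r ler_nat.
rewrite -E0 -U in IH2 IH0 IH1 *.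
(* The map u (1 - u / 2) increases on [0, 1], so the inductive bound [u] may replace [e0]. *)
have : e0 * (1 - e0 / 2) <= u * (1 - u / 2) by nra.
move/le_trans; apply.
have -> : n.+3%:R = n.+2%:R + 1 :> R by rewrite -[n.+3]addn1 natrD.
rewrite U; move: n2; move: (n.+2%:R : R) => v v0.
rewrite -subr_ge0.
have -> : 2 / (v + 1) - 2 / v * (1 - 2 / v / 2) = 2 / (v ^+ 2 * (v + 1)).
  by field; apply/andP; split; lra.
by rewrite divr_ge0// mulr_ge0 ?exprn_ge0//; lra.
Qed.

Context (A : (T -> R) -> Prop) (uaA : uniform_algebra A).

Lemma ua_scale (c : R) f : A f -> A (fun x => c * f x).
Proof. by move=> Af; apply: (ua_mul uaA) => //; exact: (ua_cst uaA). Qed.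

(** Dividing by a bound brings [f] into [-1, 1], where [abs_approx] stays in [A] and converges
    uniformly to the absolute value. *)
Lemma ua_abs f : A f -> A (fun x => `|f x|).
Proof.
move=> Af; have [M [M0 fM]] := bddP (ua_bdd uaA Af).
pose g x := M^-1 * f x.
have Ag : A g by exact: ua_scale.
have g1 x : `|g x| <= 1.
  by rewrite normrM gtr0_norm ?invr_gt0// ler_pdivrMl// mulr1.
have -> : (fun x => `|f x|) = (fun x => M * `|g x|).
  apply/funext => x; rewrite normrM [`|M^-1|]gtr0_norm ?invr_gt0//.
  by rewrite mulrA mulfV ?gt_eqF// mul1r.
apply: ua_scale; apply: (ua_unif uaA) => e e0.
pose n := Num.bound (2 / e).
exists (abs_approx g n).
  elim: n => [|n IH] /=; first exact: (ua_cst uaA).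
  apply: (ua_add uaA) => //; apply: ua_scale; apply: (ua_add uaA); first exact: (ua_mul uaA).
  by apply: ua_scale; exact: (ua_mul uaA).
move=> x; have [/andP[h0 _] h] := abs_approx_error n (g1 x).
rewrite ger0_norm//; apply: (le_trans h).
rewrite ler_pdivrMr// mulrC -ler_pdivrMr//.
have /ltW/le_trans -> // : 2 / e < n%:R.
  by apply: archi_boundP; rewrite divr_ge0// ltW.
by rewrite ler_nat -addn2 leq_addr.
Qed.

Lemma ua_max f g : A f -> A g -> A (fun x => Num.max (f x) (g x)).
Proof.
move=> Af Ag.
have -> : (fun x => Num.max (f x) (g x)) =
  (fun x => 2^-1 * (f x + (g x + `|f x + -1 * g x|))).
  apply/funext => x; rewrite mulN1r.
  by case: (leP (f x) (g x)) => h; [rewrite ler0_norm|rewrite gtr0_norm]; lra.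
apply: ua_scale; apply: (ua_add uaA) => //; apply: (ua_add uaA) => //.
by apply: ua_abs; apply: (ua_add uaA) => //; exact: ua_scale.
Qed.

Lemma ua_sum (I : Type) (s : seq I) (F : I -> T -> R) :
  (forall i, A (F i)) -> A (fun x => \sum_(i <- s) F i x).
Proof.
move=> AF; elim: s => [|i s IH].
  by under eq_fun do rewrite big_nil; exact: (ua_cst uaA).
by under eq_fun do rewrite big_cons; exact: (ua_add uaA).
Qed.

Lemma ua_bigmax (I : Type) (s : seq I) (F : I -> T -> R) :
  (forall i, A (F i)) -> A (fun x => \big[Num.max/0]_(i <- s) F i x).
Proof.
move=> AF; elim: s => [|i s IH].
  by under eq_fun do rewrite big_nil; exact: (ua_cst uaA).
by under eq_fun do rewrite big_cons; exact: ua_max.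
Qed.

End UniformAlgebra.

Section LowerDense.
Context (R : realType) (T : topologicalType).

(* The topology of [T] is (coarser than) the initial one for the family [a]. *)
Definition generates (J : countType) (a : J -> T -> R) : Prop :=
  forall x (U : set T), nbhs x U ->
  exists (l : seq J) (e : R), 0 < e /\
    forall y, (forall j, j \in l -> `|a j y - a j x| < e) -> U y.

(** Each such [F] is the pointwise supremum of the [phi k] below it. Countability of [K] lets finite
    maxima of these converge to [F] along a sequence, so that dominated convergence applies. *)
Definition lower_dense (K : countType) (phi : K -> T -> R) : Prop :=
  forall F : T -> R, continuous F -> (forall x, 0 <= F x) ->
  forall x (e : R), 0 < e ->
  exists k, (forall y, phi k y <= F y) /\ F x - e < phi k x.

(** A peak of height q and slope n around the point whose [a]-coordinates are close to the numbers
    listed in [k.2]. All parameters are rational or integral, so that there are only countably many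
    peaks. *)
Definition spike (J : countType) (a : J -> T -> R)
    (k : rat * nat * seq (J * rat)) (y : T) : R :=
  Num.max 0 (ratr k.1.1 + - k.1.2%:R *
    \sum_(jc <- k.2) `|a jc.1 y + - ratr jc.2|).

Lemma rat_approx (x e : R) : 0 < e -> exists q : rat, `|x - ratr q| < e.
Proof.
move=> e0; have /rat_in_itvoo[q] : x - e < x + e by lra.
by rewrite in_itv/= => /andP[q1 q2]; exists q; rewrite ltr_distlC ltrBlDr -ltrBlDr q1.
Qed.

(** For [q] slightly below [F x], a peak of height [q] that vanishes off a neighbourhood of [x] on
    which [F] exceeds [q] lies below [F]. *)
Lemma spike_lower_dense (J : countType) (a : J -> T -> R) :
  generates a -> lower_dense (spike a).
Proof.
move=> ga F cF F0 x e e0.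
have [Fx0|Fx] := leP (F x) 0.
  have s0 y : spike a (0, 0%N, [::]) y = 0.
    by rewrite /spike /= big_nil mulr0 addr0 rmorph0 maxxx.
  by exists (0, 0%N, [::]); split => [y|]; rewrite s0//; lra.
have [q] : exists q : rat, Num.max 0 (F x - e / 2) < ratr q < F x.
  have /rat_in_itvoo[q] : Num.max 0 (F x - e / 2) < F x.
    by rewrite gt_max Fx; lra.
  by rewrite in_itv/=; exists q.
rewrite gt_max => /andP[/andP[q0 q1] q2].
have nU : nbhs x [set y | ratr q < F y].
  have := cF x [set r | ratr q < r]; apply.
  by apply: open_nbhs_nbhs; split => //; exact: open_gt.
have [l [d [d0 ld]]] := ga x _ nU.
(* With this slope the spike is zero as soon as one coordinate is at distance at least d / 2 from
   its rational centre. *)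
pose n := Num.bound (ratr q / (d / 2) : R).
have n0 : ratr q < n%:R * (d / 2) :> R.
  rewrite -ltr_pdivrMr ?divr_gt0//; apply: archi_boundP.
  by apply: divr_ge0; [exact: ltW|lra].
(* The first bound turns closeness to the centre [c j] into closeness to [a j x]; the second keeps
   the spike at [x] above [q - e / 2]. Adding 1 avoids a zero denominator. *)
pose eta : R := Num.min (d / 2) (e / 2 / (n%:R * (size l)%:R + 1)).
have eta0 : 0 < eta.
  by rewrite lt_min !divr_gt0//= ltr_wpDl.
have [c cP] := choice (fun j => rat_approx (a j x) eta0).
pose L := [seq (j, c j) | j <- l].
exists (q, n, L); split.
  move=> y; rewrite /spike /= ge_max F0/=.
  have [h|h] := ltP (ratr q) (n%:R * \sum_(jc <- L) `|a jc.1 y + - ratr jc.2|).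
    by rewrite mulNr; apply: le_trans (F0 y); lra.
  have Sge0 : 0 <= \sum_(jc <- L) `|a jc.1 y + - ratr jc.2|.
    by apply: sumr_ge0 => *.
  suff /ltW : ratr q < F y.
    by apply: le_trans; rewrite mulNr gerDl oppr_le0 mulr_ge0.
  apply: ld => j jl.
  have n00 : 0 < n%:R :> R.
    rewrite ltr0n lt0n; apply/eqP => n00; move: n0; rewrite n00 mul0r.
    by move=> /(lt_trans q0); rewrite ltxx.
  have : `|a j y + - ratr (c j)| < d / 2.
    rewrite -(ltr_pM2l n00); apply: le_lt_trans n0; apply: le_trans h.
    rewrite ler_pM2l// big_map (big_rem j jl)/= lerDl.
    by apply: sumr_ge0 => *.
  have := cP j; rewrite lt_min => /andP[+ _].
  rewrite distrC => h1 h2.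
  rewrite (_ : a j y - a j x = (a j y + - ratr (c j)) + (ratr (c j) - a j x)).
    by rewrite (le_lt_trans (ler_normD _ _))//; lra.
  by ring.
rewrite /spike /= lt_max; apply/orP; right.
have : n%:R * (\sum_(jc <- L) `|a jc.1 x + - ratr jc.2|) <= e / 2.
  have : \sum_(jc <- L) `|a jc.1 x + - ratr jc.2| <= \sum_(j <- l) eta.
    by rewrite big_map; apply: ler_sum => j _; exact/ltW/cP.
  rewrite big_const_seq iter_addr_0 count_predT => h.
  have /le_trans -> // : n%:R * (\sum_(jc <- L) `|a jc.1 x + - ratr jc.2|) <=
     (n%:R * (size l)%:R + 1) * eta.
    rewrite -[eta *+ _]mulr_natl in h.
    rewrite mulrDl mul1r -mulrA (le_trans (ler_wpM2l _ h))//.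
    by rewrite lerDl ltW.
  rewrite mulrC -ler_pdivlMr ?ltr_wpDl//.
  by rewrite ge_min lexx orbT.
by rewrite mulNr; move: q1; lra.
Qed.

Lemma ua_spike (A : (T -> R) -> Prop) (J : countType) (a : J -> T -> R) k :
  uniform_algebra A -> (forall j, A (a j)) -> A (spike a k).
Proof.
move=> ua Aa; apply: (ua_max ua); first exact: (ua_cst ua).
apply: (ua_add ua); first exact: (ua_cst ua).
apply: (ua_scale ua); apply: (ua_sum ua) => jc; apply: (ua_abs ua).
by apply: (ua_add ua) => //; exact: (ua_cst ua).
Qed.

Context (K : countType) (phi : K -> T -> R).

Definition maxs (s : seq K) (y : T) : R := \big[Num.max/0]_(k <- s) phi k y.

Lemma maxs_ge0 s y : 0 <= maxs s y.
Proof. by rewrite /maxs; elim: s => [|k s IH]; rewrite ?big_nil ?big_cons// le_max IH orbT. Qed.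

Lemma maxs_le s y M : 0 <= M -> (forall k, k \in s -> phi k y <= M) -> maxs s y <= M.
Proof.
rewrite /maxs => M0; elim: s => [|k s IH] sM; rewrite ?big_nil ?big_cons//.
rewrite ge_max sM ?mem_head//= IH// => j js; apply: sM.
by rewrite inE js orbT.
Qed.

Lemma maxs_ge s y k : k \in s -> phi k y <= maxs s y.
Proof.
rewrite /maxs; elim: s => // j s IH; rewrite inE big_cons le_max.
by move=> /orP[/eqP->|/IH->]; rewrite ?lexx ?orbT.
Qed.

(** As [n] grows, these finite sequences exhaust the indices of all [phi k] lying below [F], in the
    order of their codes. *)
Definition minorants (F : T -> R) (n : nat) : seq K :=
  [seq k <- pmap unpickle (iota 0 n) | `[< forall y, phi k y <= F y >]].

Lemma maxs_minorants_le (F : T -> R) n y : (forall x, 0 <= F x) -> maxs (minorants F n) y <= F y.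
Proof.
move=> F0; apply: maxs_le => // k.
by rewrite mem_filter => /andP[/asboolP].
Qed.

Hypothesis ld : lower_dense phi.

Lemma cvg_maxs_minorants (F : T -> R) y : continuous F -> (forall x, 0 <= F x) ->
  (fun n => maxs (minorants F n) y) @ \oo --> F y.
Proof.
move=> cF F0; apply/cvgrPdist_le => e e0.
have [k [kF Fk]] := ld cF F0 y e0.
near=> n.
rewrite ger0_norm ?subr_ge0 ?maxs_minorants_le//.
rewrite lerBlDl -lerBlDr; apply: (le_trans (ltW Fk)); apply: maxs_ge.
rewrite mem_filter; apply/andP; split; first exact/asboolP.
rewrite mem_pmap; apply/mapP; exists (pickle k); last by rewrite pickleK.
by rewrite mem_iota /= add0n; near: n; exists (pickle k).+1.
Unshelve. all: by end_near. Qed.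

Section Approx.
Context (d : measure_display) (Om : measurableType d) (P : probability Om R).
Context (Y : Om -> T) (mphi : forall k, measurable_fun setT (phi k \o Y)).

Lemma measurable_maxs s : measurable_fun setT (maxs s \o Y).
Proof.
rewrite /maxs /comp; elim: s => [|k s IH].
  by under eq_fun do rewrite big_nil; exact: measurable_cst.
under eq_fun do rewrite big_cons.
by apply: measurable_maxr => //; exact: mphi.
Qed.

(** [F \o Y] is a pointwise limit of finite maxima of the [phi k \o Y], so its measurability comes
    from theirs rather than from Borel sets of [T]. *)
Lemma measurable_continuous_comp (F : T -> R) : continuous F -> (forall x, 0 <= F x) ->
  measurable_fun setT (F \o Y).
Proof.
move=> cF F0.
apply: (@measurable_fun_cvg _ _ _ _ (fun n => maxs (minorants F n) \o Y)).
  by move=> n; exact: measurable_maxs.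
by move=> w _; exact: cvg_maxs_minorants.
Qed.

Lemma Ex_lower_approx (F : T -> R) (e : R) : continuous F -> (forall x, 0 <= F x) ->
  bounded_by_some F -> 0 < e ->
  exists s, (forall y, maxs s y <= F y) /\
   \int[P]_w F (Y w) - e <= \int[P]_w maxs s (Y w).
Proof.
move=> cF F0 [M FM] e0.
have : (fun n => \int[P]_w maxs (minorants F n) (Y w))%R @ \oo -->
    (\int[P]_w F (Y w))%R.
  apply: (@Ex_dct _ _ _ _ _ _ M) => //.
  - by move=> n; exact: measurable_maxs.
  - exact: measurable_continuous_comp.
  - move=> n w; rewrite ger0_norm ?maxs_ge0//.
    apply: le_trans (FM (Y w)); rewrite (ger0_norm (F0 _)).
    exact: maxs_minorants_le.
  - by apply: aeW => w; exact: cvg_maxs_minorants.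
move=> /cvgrPdist_le /(_ _ e0)[n _ /(_ n (leqnn n)) h].
exists (minorants F n); split; first by move=> y; exact: maxs_minorants_le.
by move: h; rewrite ler_norml => /andP[_]; rewrite lerBlDl lerBlDr addrC.
Qed.

End Approx.
End LowerDense.

(** * A criterion for convergence in law *)

Section Criterion.
Context (R : realType) (d : option R -> measure_display)
  (Om : forall r, measurableType (d r)) (P : forall r, probability (Om r) R).

Definition cvgE (g : forall r, Om r -> R) : Prop :=
  (\int[P (Some r)]_w g (Some r) w)%R @[r --> +oo] --> (\int[P None]_w g None w)%R.

Lemma near_Rplus_oo : \forall r \near +oo, @Rplus_oo R (Some r).
Proof. by apply: nbhs_pinfty_ge; exact: num_real. Qed.

(** Equality on R_+ and at infinity suffices, since negative [r] are eventually left behind. *)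
Lemma eq_cvgE (f g : forall r, Om r -> R) :
  (forall r : option R, Rplus_oo r -> (\int[P r]_w f r w = \int[P r]_w g r w)%R) ->
  cvgE f -> cvgE g.
Proof.
move=> fg; rewrite /cvgE -(fg None)//; apply: cvg_trans; apply: near_eq_cvg.
by near do rewrite fg//; exact: near_Rplus_oo.
Unshelve. all: by end_near. Qed.

Definition bm_family (g : forall r, Om r -> R) : Prop :=
  forall r : option R, Rplus_oo r -> bm (g r).

Lemma cvgE_cst (c : R) : cvgE (fun _ _ => c).
Proof.
rewrite /cvgE Ex_cst; under eq_fun do rewrite Ex_cst.
exact: cvg_cst.
Qed.

Lemma cvgE_add f g : bm_family f -> bm_family g -> cvgE f -> cvgE g ->
  cvgE (fun r w => f r w + g r w).
Proof.
move=> bf bg cf cg; rewrite /cvgE ExD; [|exact: bf|exact: bg].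
apply: cvg_trans (cvgD cf cg); apply: near_eq_cvg.
near=> r; have r0 : Rplus_oo (Some r) by near: r; exact: near_Rplus_oo.
by rewrite ExD//; [exact: bf|exact: bg].
Unshelve. all: by end_near. Qed.

Lemma cvgE_scale (c : R) f : bm_family f -> cvgE f -> cvgE (fun r w => c * f r w).
Proof.
move=> bf cf; rewrite /cvgE ExZ; last exact: bf.
have h : (c * \int[P (Some r)]_w f (Some r) w)%R @[r --> +oo] -->
    (c * \int[P None]_w f None w)%R by apply: cvgM; [exact: cvg_cst|exact: cf].
apply: cvg_trans h; apply: near_eq_cvg.
near=> r; have r0 : Rplus_oo (Some r) by near: r; exact: near_Rplus_oo.
by rewrite ExZ//; exact: bf.
Unshelve. all: by end_near. Qed.

Lemma cvgE_sum (I : Type) (s : seq I) (F : I -> forall r, Om r -> R) :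
  (forall i, bm_family (F i)) -> (forall i, cvgE (F i)) ->
  cvgE (fun r w => \sum_(i <- s) F i r w).
Proof.
move=> bF cF; elim: s => [|i s IH].
  apply: (@eq_cvgE (fun _ _ => 0)); last exact: cvgE_cst.
  by move=> r _; apply: eq_Rintegral => w _; rewrite big_nil.
apply: (@eq_cvgE (fun r w => F i r w + \sum_(j <- s) F j r w)).
  by move=> r _; apply: eq_Rintegral => w _; rewrite big_cons.
by apply: cvgE_add => // r r0; apply: bm_sum => j; exact: bF.
Qed.

Context (T : topologicalType) (Y : forall r, Om r -> T).
Arguments Y : clear implicits.

(** Goodness passes to linear combinations and uniform limits, but not visibly to products; this is
    why multipliers are introduced below. *)
Definition good (f : T -> R) : Prop :=
  [/\ bounded_by_some f,
      forall r : option R, Rplus_oo r -> measurable_fun setT (f \o Y r) &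
      cvgE (fun r w => f (Y r w))].

Lemma good_bm f : good f -> bm_family (fun r w => f (Y r w)).
Proof. by move=> [[M fM] mf _] r r0; split; [exact: mf|exists M]. Qed.

Lemma good_add f g : good f -> good g -> good (fun x => f x + g x).
Proof.
move=> gf gg; have bf := good_bm gf; have bg := good_bm gg.
move: gf gg => [bbf mf cf] [bbg mg cg]; split; first exact: bddD.
  by move=> r r0; apply: measurable_funD; [exact: mf|exact: mg].
exact: cvgE_add.
Qed.

(** Measurability passes to the limit of a sequence of approximants; convergence follows by
    splitting the error into three parts of size e / 3. *)
Lemma good_unif f : (forall e : R, 0 < e ->
    exists2 g, good g & forall x, `|f x - g x| <= e) -> good f.
Proof.
move=> fg.
have bf : bounded_by_some f.
  by apply: bdd_unif => e /fg[g [bg _ _] h]; exists g.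
have mf r : Rplus_oo r -> measurable_fun setT (f \o Y r).
  move=> r0.
  have n0 n : 0 < n.+1%:R^-1 :> R by rewrite invr_gt0.
  have /choice[g gP] : forall n, exists g, good g /\ forall x, `|f x - g x| <= n.+1%:R^-1.
    by move=> n; have [g ? ?] := fg _ (n0 n); exists g.
  apply: (@measurable_fun_cvg _ _ _ _ (fun n => g n \o Y r)).
    by move=> n; have [[_ + _] _] := gP n; exact.
  move=> w _ /=; apply/cvgrPdist_le => e e0; near=> n.
  have [_ /(_ (Y r w))/le_trans] := gP n; apply.
  apply: ltW; near: n; exact: near_infty_natSinv_lt (PosNum e0).
split=> //; apply/cvgrPdist_le => e e0.
have e3 : 0 < e / 3 by rewrite divr_gt0.
have [g gg h] := fg _ e3; have bg := good_bm gg.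
have [_ _ /cvgrPdist_le /(_ _ e3) cg] := gg.
have bmf : bm_family (fun r w => f (Y r w)).
  by case: bf => M fM r r0; split; [exact: mf|exists M].
near=> r; have r0 : Rplus_oo (Some r) by near: r; exact: near_Rplus_oo.
have h0 : `|(\int[P None]_w f (Y None w))%R - (\int[P None]_w g (Y None w))%R| <= e / 3.
  by apply: Ex_dist => //; [exact: bmf|exact: bg].
have hr : `|(\int[P (Some r)]_w f (Y (Some r) w))%R - (\int[P (Some r)]_w g (Y (Some r) w))%R| <= e / 3.
  by apply: Ex_dist => //; [exact: bmf|exact: bg].
have hg : `|(\int[P None]_w g (Y None w))%R - (\int[P (Some r)]_w g (Y (Some r) w))%R| <= e / 3.
  by near: r.
by move: h0 hr hg; rewrite !ler_norml => /andP[? ?] /andP[? ?] /andP[? ?]; apply/andP; split; lra.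
Unshelve. all: by end_near. Qed.

Context (J : countType) (a : J -> T -> R).

Let mon (s : seq J) (x : T) : R := \prod_(j <- s) a j x.

Hypothesis good_mon : forall s, good (mon s).

Let mon_module (b : T -> R) : Prop := forall s, good (fun x => b x * mon s x).

(* The multipliers of [mon_module], unlike [mon_module] itself, are visibly
   stable under products. *)
Let multiplier (f : T -> R) : Prop :=
  bounded_by_some f /\ forall b, mon_module b -> mon_module (fun x => f x * b x).

Let good_scale c f : good f -> good (fun x => c * f x).
Proof.
move=> gf; have bf := good_bm gf; case: gf => bbf mf cf; split.
- by apply: bddM => //; exact: bdd_cst.
- by move=> r r0; apply: measurable_funM; [exact: measurable_cst|exact: mf].
- exact: cvgE_scale.
Qed.

Let multiplier_ua : uniform_algebra multiplier.
Proof.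
split.
- by move=> f [].
- move=> c; split; first exact: bdd_cst.
  by move=> b mb s; under eq_fun do rewrite -mulrA; exact: good_scale.
- move=> f g [bf mf] [bg mg]; split; first exact: bddD.
  move=> b mb s; under eq_fun do rewrite mulrDl mulrDl.
  by apply: good_add; [exact: mf|exact: mg].
- move=> f g [bf mf] [bg mg]; split; first exact: bddM.
  by move=> b mb; under eq_fun do rewrite -mulrA; apply/mf/mg.
- move=> f fg; have bf : bounded_by_some f.
    by apply: bdd_unif => e /fg[g [bg _] h]; exists g.
  split=> // b mb s; apply: good_unif => e e0.
  (* The fixed factor is good, hence bounded by some [K]; an error e / K in [f] then costs at most e
     in the product. *)
  have [K [K0 bK]] : exists K : R, 0 < K /\ forall x, `|b x * mon s x| <= K.
    by apply: bddP; have [] := mb s.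
  have eK : 0 < e / K by rewrite divr_gt0.
  have [g [bg mg] h] := fg _ eK.
  exists (fun x => g x * b x * mon s x); first exact: mg.
  move=> x; rewrite -mulrBl -mulrBl -mulrA normrM.
  have -> : e = e / K * K by rewrite divfK ?gt_eqF.
  exact: ler_pM.
Qed.

Let multiplier_atom j : multiplier (a j).
Proof.
split.
  have [[M h] _ _] := good_mon [:: j]; exists M => x.
  by have := h x; rewrite /mon big_seq1.
move=> b mb s; have := mb (j :: s); congr good; apply/funext => x.
by rewrite /mon big_cons mulrCA mulrA.
Qed.

(** The constant 1 lies in [mon_module] by [good_mon], so a multiplier applied to it, with the empty
    monomial, is good. Maxima of spikes are multipliers because these form a uniform algebra
    containing the [a j]. *)
Let good_maxs s : good (maxs (spike a) s).
Proof.
have ua := multiplier_ua.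
have [_] : multiplier (maxs (spike a) s).
  by apply: (ua_bigmax ua) => k; apply: (ua_spike k ua); exact: multiplier_atom.
have m1 : mon_module (fun=> 1).
  by move=> t; under eq_fun do rewrite mul1r; exact: good_mon.
move=> /(_ _ m1 [::]); congr good; apply/funext => x.
by rewrite /mon big_nil !mulr1.
Qed.

Hypothesis ga : generates a.

Let measurable_spike r k : Rplus_oo r -> measurable_fun setT (spike a k \o Y r).
Proof.
move=> r0; apply: measurable_maxr; first exact: measurable_cst.
apply: measurable_funD; first exact: measurable_cst.
apply: measurable_funM; first exact: measurable_cst.
have mS (l : seq (J * rat)) : measurable_fun setT
    (fun w => \sum_(jc <- l) `|a jc.1 (Y r w) + - ratr jc.2|).
  elim: l => [|jc l IH].
    by under eq_fun do rewrite big_nil; exact: measurable_cst.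
  under eq_fun do rewrite big_cons.
  apply: measurable_funD => //.
  apply: measurableT_comp => //; apply: measurable_funD; last exact: measurable_cst.
  have [_ + _] := good_mon [:: jc.1].
  move=> /(_ _ r0); congr measurable_fun; apply/funext => w.
  by rewrite /= /mon big_seq1.
exact: mS.
Qed.

(** A maximum of spikes below [F] nearly attains the limiting expectation of [F]; its own
    expectations converge and bound those of [F] from below. *)
Let liminf (F : T -> R) (e : R) : continuous F -> (forall x, 0 <= F x) ->
  bounded_by_some F -> 0 < e -> \forall r \near +oo,
  (\int[P None]_w F (Y None w) - e <= \int[P (Some r)]_w F (Y (Some r) w))%R.
Proof.
move=> cF F0 bF e0.
have ld := spike_lower_dense ga.
have e2 : 0 < e / 2 by rewrite divr_gt0.
have [s [sF hs]] := Ex_lower_approx ld (P None)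
  (fun k => @measurable_spike None k I) cF F0 bF e2.
have gs := good_maxs s; have bs := good_bm gs.
case: gs => [_ _ /cvgrPdist_le /(_ _ e2) cs].
near=> r; have r0 : Rplus_oo (Some r) by near: r; exact: near_Rplus_oo.
have : (\int[P (Some r)]_w maxs (spike a) s (Y (Some r) w) <=
        \int[P (Some r)]_w F (Y (Some r) w))%R.
  apply: Ex_le => //; first exact: bs.
  split; last by case: bF => M FM; exists M.
  by apply: (measurable_continuous_comp ld) => // k; exact: measurable_spike.
have : `|(\int[P None]_w maxs (spike a) s (Y None w))%R -
        (\int[P (Some r)]_w maxs (spike a) s (Y (Some r) w))%R| <= e / 2.
  by near: r.
by rewrite ler_norml => /andP[? ?] ?; lra.
Unshelve. all: by end_near. Qed.

Lemma cvg_in_law_generates : cvg_in_law P Y.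
Proof.
move=> F cF [M FM].
have ld := spike_lower_dense ga.
(* Both functions are nonnegative; their lower bounds give the lower and the upper estimate for
   [F]. *)
pose F1 x := M + F x; pose F2 x := M + -1 * F x.
have F10 x : 0 <= F1 x by have := FM x; rewrite ler_norml /F1 => /andP[? ?]; lra.
have F20 x : 0 <= F2 x by have := FM x; rewrite ler_norml /F2 => /andP[? ?]; lra.
have cF1 : continuous F1 by move=> x; apply: cvgD; [exact: cvg_cst|exact: cF].
have cF2 : continuous F2.
  move=> x; apply: cvgD; first exact: cvg_cst.
  by apply: cvgM; [exact: cvg_cst|exact: cF].
have bF : bounded_by_some F by exists M.
have bF1 : bounded_by_some F1 by apply: bddD => //; exact: bdd_cst.
have bF2 : bounded_by_some F2.
  by apply: bddD; [|apply: bddM => //]; exact: bdd_cst.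
have bmF r : Rplus_oo r -> bm (F \o Y r).
  move=> r0; split; last by exists M => w; exact: FM.
  have : measurable_fun setT (F1 \o Y r).
    by apply: (measurable_continuous_comp ld) => // k; exact: measurable_spike.
  move=> m1; have := measurable_funD m1 (@measurable_cst _ _ _ _ setT (- M)).
  by congr measurable_fun; apply/funext => w; rewrite /= /F1; ring.
have E1 r : Rplus_oo r -> (\int[P r]_w F1 (Y r w) = M + \int[P r]_w F (Y r w))%R.
  by move=> r0; rewrite ExD ?Ex_cst//; [exact: bm_cst|exact: bmF].
have E2 r : Rplus_oo r -> (\int[P r]_w F2 (Y r w) = M + -1 * \int[P r]_w F (Y r w))%R.
  move=> r0; rewrite ExD ?Ex_cst ?ExZ//; [exact: bmF|exact: bm_cst|].
  by apply: bmZ; exact: bmF.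
apply/cvgrPdist_le => e e0.
near=> r; have r0 : Rplus_oo (Some r) by near: r; exact: near_Rplus_oo.
have : (\int[P None]_w F1 (Y None w) - e <= \int[P (Some r)]_w F1 (Y (Some r) w))%R.
  by near: r; exact: liminf.
have : (\int[P None]_w F2 (Y None w) - e <= \int[P (Some r)]_w F2 (Y (Some r) w))%R.
  by near: r; exact: liminf.
by rewrite !E1// !E2// ler_norml => ? ?; apply/andP; split; lra.
Unshelve. all: by end_near. Qed.

End Criterion.

(** * Monomials in a system and its measure vector *)

Lemma measurable_fun_open (R : realType) (d : measure_display)
    (Om : measurableType d) (f : Om -> R) :
  (forall U : set R, open U -> measurable (f @^-1` U)) -> measurable_fun setT f.
Proof.
move=> fU mD; apply: (measurability _ (RGenOInfty.measurableE R)) => //.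
move=> /= _ [_ [x ->] <-]; rewrite setTI; apply: fU.
rewrite set_itvE; exact: open_gt.
Qed.

Lemma prod_proj_continuous (I : Type) (T : I -> topologicalType) (i : I) :
  continuous (fun x : prod_topology T => x i).
Proof.
move=> x; have /cvg_sup/(_ i) h : x --> x by apply: cvg_id.
move=> A /= nA; apply: h.
exact: (@initial_continuous _ _ (fun f : (forall i, T i) => f i) x A nA).
Qed.

Section Monomials.
Context (R : realType) (C : nat) (N : 'I_C -> option nat)
  (S : 'I_C -> ptopologicalType).

(* One test function for each class, so that monomials need no dependent pairs. *)
Definition test := forall i : 'I_C, bcfun R (S i).

Definition tval (f : test) (i : 'I_C) : S i -> R := proj1_sig (f i).

Definition ev (f : test) (i : 'I_C) (mu : mvec_space R S) : R :=
  integ_map (mu i : Prob R (S i)) (f i).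

Lemma tval_continuous f i : continuous (tval f (i := i)).
Proof. by rewrite /tval; case: (f i) => ? []. Qed.

Lemma tval_bdd f i : bounded_by_some (tval f (i := i)).
Proof. by rewrite /tval; case: (f i) => ? []. Qed.

Lemma ev_continuous f i : continuous (@ev f i).
Proof.
move=> mu; rewrite /ev.
have h1 := @prod_proj_continuous _ (fun i => (weakP R (S i) : topologicalType)) i mu.
have h2 := @initial_continuous _ _ (@integ_map R (S i)) (mu i).
have h3 := @prod_proj_continuous _ (fun _ : bcfun R (S i) => (R : topologicalType)) (f i)
  (@integ_map R (S i) (mu i)).
move=> A nA; exact: h1 _ (h2 _ (h3 A nA)).
Qed.

Lemma tval_measurable f i : measurable_fun setT (tval f (i := i) : borelType (S i) -> R).
Proof.
apply: measurable_fun_open => U oU; apply: sub_sigma_algebra.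
by have /continuousP := @tval_continuous f i; apply.
Qed.

Lemma ev_bound f i (mu : mvec_space R S) M : (forall x, `|tval f (i := i) x| <= M) ->
  `|ev f i mu| <= M.
Proof.
move=> fM; apply: Ex_bound => //; split; last by exists M.
exact: tval_measurable.
Qed.

(** Allows two factors at the same coordinate to be merged into one. *)
Definition tmul (f g : test) : test.
Proof.
move=> i; exists (fun x => tval f x * tval g x); split.
  by move=> x; apply: cvgM; exact: tval_continuous.
by apply: bddM; exact: tval_bdd.
Defined.

(** Indexed by all natural numbers, so that monomials carry no membership proofs; [valid] confines
    them to the true index sets. *)
Definition config := forall i : 'I_C, nat -> S i.

Definition monX (xs : seq ('I_C * nat * test)) (x : config) : R :=
  \prod_(a <- xs) tval a.2 (x a.1.1 a.1.2).

Definition monL (ls : seq ('I_C * test)) (mu : mvec_space R S) : R :=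
  \prod_(b <- ls) ev b.2 b.1 mu.

(* Number of coordinates averaged by the empirical measure truncated at [M]. *)
Definition pop (i : 'I_C) (M : nat) : nat := if N i is Some m then m else M.

Definition emp (M : nat) (i : 'I_C) (f : test) (x : config) : R :=
  (pop i M)%:R^-1 * \sum_(1 <= n < (pop i M).+1) tval f (x i n).

(** A substitute for [monL] that depends on the configuration alone, so that exchangeability, a
    statement about [X] only, applies to it. *)
Definition monE (M : nat) (ls : seq ('I_C * test)) (x : config) : R :=
  \prod_(b <- ls) emp M b.1 b.2 x.

Definition valid (xs : seq ('I_C * nat * test)) : bool :=
  all (fun a => inI (N a.1.1) a.1.2) xs.

Lemma monX_bdd xs : bounded_by_some (monX xs).
Proof.
rewrite /monX; elim: xs => [|a xs IH].
  by under eq_fun do rewrite big_nil; exact: bdd_cst.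
under eq_fun do rewrite big_cons.
apply: bddM => //; have [M fM] := tval_bdd a.2 a.1.1.
by exists M => x; exact: fM.
Qed.

Lemma emp_bound M i f (x : config) K : 0 <= K ->
  (forall y, `|tval f (i := i) y| <= K) -> `|emp M i f x| <= K.
Proof.
move=> K0 fK; rewrite /emp; case: (pop i M) => [|m].
  by rewrite big_geq// mulr0 normr0.
rewrite normrM ger0_norm ?invr_ge0// ler_pdivrMl// mulr_natl.
apply: (le_trans (ler_norm_sum _ _ _)).
apply: (le_trans (ler_sum _ (fun n _ => fK _))).
by rewrite sumr_const_nat subn1.
Qed.

(** The bound is uniform in [M], as dominated convergence for M tending to infinity requires. *)
Lemma monE_bdd ls : exists K, (forall M x, `|monE M ls x| <= K) /\
  (forall mu, `|monL ls mu| <= K).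
Proof.
rewrite /monE /monL; elim: ls => [|b ls [K [h1 h2]]].
  by exists 1; split=> *; rewrite big_nil normr1.
have [L [L0 fL]] := bddP (tval_bdd b.2 b.1).
exists (L * K); split=> [M x|mu]; rewrite big_cons normrM ler_pM//.
  by apply: emp_bound => //; exact: ltW.
exact: ev_bound.
Qed.

(** A coordinate already present absorbs the new factor into its test function. The length does not
    grow, which serves the induction on the number of factors. *)
Lemma monX_merge i n g xs : valid xs -> has (fun a => a.1 == (i, n)) xs ->
  exists xs', [/\ valid xs', size xs' = size xs &
    forall x, monX ((i, n, g) :: xs) x = monX xs' x].
Proof.
elim: xs => //= -[a h] xs IH /andP[va vxs] /orP[/eqP/= ain|hxs].
  exists ((a, tmul g h) :: xs); split=> //=; first by rewrite va.
  by move=> x; rewrite /monX !big_cons mulrA; subst a.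
have [xs' [v' s' m']] := IH vxs hxs.
exists ((a, h) :: xs'); split=> /=; rewrite ?s'// ?va//.
by move=> x; have := m' x; rewrite /monX !big_cons/= => <-; rewrite mulrCA.
Qed.

End Monomials.

(** * Expectations under equal laws *)

Section EqualLaw.
Context (R : realType) (d : measure_display) (Om : measurableType d)
  (P : probability Om R) (T : pointedType) (G : set (set T)).

(** Both expectations are integrals of [h] against image measures, and these agree on the
    sigma-algebra generated by [G]. *)
Lemma Ex_eq_law (U V : Om -> g_sigma_algebraType G) (h : g_sigma_algebraType G -> R) :
  (forall A, G A -> measurable (U @^-1` A)) ->
  (forall A, G A -> measurable (V @^-1` A)) ->
  (forall A, <<s G >> A -> P (U @^-1` A) = P (V @^-1` A)) ->
  measurable_fun setT h -> bounded_by_some h ->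
  (\int[P]_w h (U w) = \int[P]_w h (V w))%R.
Proof.
move=> mU mV UV mh [M hM].
have mapm (W : Om -> g_sigma_algebraType G) :
    (forall A, G A -> measurable (W @^-1` A)) -> measurable_fun setT W.
  move=> mW; apply: (@measurability _ _ Om (g_sigma_algebraType G) setT W G erefl).
  by move=> _ [A GA <-]; rewrite setTI; exact: mW.
have {}mU := mapm _ mU; have {}mV := mapm _ mV.
have mh' : measurable_fun setT (EFin \o h) by exact/measurable_EFinP.
have bmh W : measurable_fun setT W -> P.-integrable setT (EFin \o (h \o W)).
  move=> mW; apply: bm_integrable; split; first exact: measurableT_comp.
  by exists M => w; exact: hM.
pose mf1 := isMeasurableFun.Build _ _ _ _ _ mU.
pose mf2 := isMeasurableFun.Build _ _ _ _ _ mV.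
pose U' : {mfun Om >-> g_sigma_algebraType G} := HB.pack U mf1.
pose V' : {mfun Om >-> g_sigma_algebraType G} := HB.pack V mf2.
have e1 := @integral_pushforward _ _ _ _ _ _ mU P setT (EFin \o h) mh' (bmh _ mU) measurableT.
have e2 := @integral_pushforward _ _ _ _ _ _ mV P setT (EFin \o h) mh' (bmh _ mV) measurableT.
rewrite preimage_setT in e1 e2.
congr fine; rewrite [LHS](esym e1) [RHS](esym e2).
apply: (@eq_measure_integral _ _ _ _ (pushforward P V')
  (pushforward P U')) => A mA _.
exact: UV.
Qed.

End EqualLaw.

(** * Integrals against an empirical measure *)

Section EmpiricalIntegral.
Context (R : realType) (d : measure_display) (T : measurableType d).

(** For nonnegative integrands [mu] is replaced by a scaled sum of Dirac masses; a bounded [f] is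
    reduced to this case by adding a bound [K]. *)
Lemma Rintegral_empirical (mu : probability T R) (m : nat) (x : nat -> T) (f : T -> R) :
  (forall B, measurable B ->
    mu B = ((m%:R)^-1 * \sum_(1 <= n < m.+1) \1_B (x n))%:E) ->
  measurable_fun setT f -> bounded_by_some f ->
  (\int[mu]_y f y = m%:R^-1 * \sum_(1 <= n < m.+1) f (x n))%R.
Proof.
move=> mumean mf bf; have [K [K0 fK]] := bddP bf.
have m0 : (0 <= m%:R^-1 :> R) by rewrite invr_ge0.
pose nu := mscale (NngNum m0) (msum (fun k => (\d_(x k.+1)%R : measure T R)) m).
have pos (g : T -> R) : measurable_fun setT g -> (forall y, 0 <= g y) ->
    (\int[mu]_y g y = m%:R^-1 * \sum_(1 <= n < m.+1) g (x n))%R.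
  move=> mg g0; have mg' : measurable_fun setT (EFin \o g) by exact/measurable_EFinP.
  rewrite /Rintegral (@eq_measure_integral _ _ _ _ nu); last first.
    move=> A mA _; apply: etrans (mumean _ mA) _; rewrite /nu /mscale/= /msum.
    rewrite EFinM; congr (_ * _)%E.
    rewrite big_add1/= big_mkord -sumEFin.
    by apply: eq_bigr => k _; rewrite /= diracE indicE.
  rewrite ge0_integral_mscale//; last by move=> y _; rewrite lee_fin.
  rewrite ge0_integral_measure_sum//; last by move=> y _; rewrite lee_fin.
  under eq_bigr do rewrite integral_dirac// diracT mul1e.
  by rewrite sumEFin -EFinM /= big_add1/= big_mkord.
have mfK : measurable_fun setT (fun y => f y + K).
  by apply: measurable_funD => //; exact: measurable_cst.
have := pos _ mfK; rewrite ExD ?Ex_cst//; last exact: bm_cst.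
have f0 y : 0 <= f y + K by have := fK y; rewrite ler_norml => /andP[? _]; lra.
move=> /(_ f0); rewrite big_split/= sumr_const_nat subn1/= mulrDr.
(* For [m = 0] the formula would give [mu] total mass 0 instead of 1. *)
have mN0 : m%:R != 0 :> R.
  apply/eqP => mz; have := mumean setT measurableT.
  rewrite mz invr0 mul0r probability_setT => /eqP.
  by rewrite eqe oner_eq0.
by rewrite -[K *+ m]mulr_natl mulrA mulVf// mul1r => /addIr.
Qed.

End EmpiricalIntegral.

(** * Transpositions of indices *)

Definition swap (k n m : nat) : nat :=
  if m == k then n else if m == n then k else m.

Lemma swapK k n : involutive (swap k n).
Proof.
by move=> m; rewrite /swap; do !case: eqP => //=; congruence.
Qed.

Lemma swap_in (Q : nat -> bool) k n m : Q k -> Q n -> Q m -> Q (swap k n m).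
Proof. by rewrite /swap; case: ifP => // _; case: ifP. Qed.

Lemma swap_perm_of (K : option nat) k n : inI K k -> inI K n ->
  is_perm_of K (swap k n).
Proof.
move=> hk hn; split.
- by move=> m hm; exact: swap_in.
- by move=> m1 m2 _ _ /(congr1 (swap k n)); rewrite !swapK.
- by move=> m hm; exists (swap k n m); rewrite swapK; split=> //; exact: swap_in.
- exists (maxn k n) => m; rewrite gtn_max /swap => /andP[mk mn].
  by rewrite !gtn_eqF.
Qed.

Lemma sum_swap (R : nmodType) (F : nat -> R) k n M :
  (0 < k <= M)%N -> (0 < n <= M)%N ->
  \sum_(1 <= m < M.+1) F (swap k n m) = \sum_(1 <= m < M.+1) F m.
Proof.
move=> hk hn; rewrite -(big_map (swap k n) xpredT); apply: perm_big.
apply: uniq_perm; rewrite ?iota_uniq//.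
  by rewrite map_inj_uniq ?iota_uniq//; exact: (can_inj (swapK _ _)).
move=> m; apply/mapP/idP => [[p hp ->]|hm].
  move: hp; rewrite !mem_index_iota !ltnS => hp.
  exact: (swap_in (Q := fun m => (0 < m <= M)%N)).
exists (swap k n m); last by rewrite swapK.
move: hm; rewrite !mem_index_iota !ltnS => hm.
exact: (swap_in (Q := fun m => (0 < m <= M)%N)).
Qed.

(** * Exchangeability within one system *)

Section System.
Context (R : realType) (C : nat) (N : 'I_C -> option nat)
  (S : 'I_C -> ptopologicalType) (d : measure_display) (Om : measurableType d)
  (P : probability Om R) (X : forall i : 'I_C, nat -> Om -> S i)
  (Lam : Om -> mvec_space R S).
Hypothesis sysX : is_system N X.
Hypothesis exchX : multi_exchangeable N P X.
Hypothesis mvX : is_measure_vector N P X Lam.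

Notation test := (test R S).
Notation config := (config S).
Implicit Types (xs : seq ('I_C * nat * test)) (ls : seq ('I_C * test)) (g : test).

Definition cfg (w : Om) : config := fun i n => X i n w.

Definition monC M xs ls (x : config) : R := monX xs x * monE N M ls x.

Section ConfigurationMeasurability.
Context (d' : measure_display) (Z : measurableType d') (c : Z -> config).
Hypothesis mc : forall (f : test) i n, inI (N i) n ->
  measurable_fun setT (fun z => tval f (c z i n)).

(** The map [c] is arbitrary because two cases are needed: the random configuration [cfg] on [Om],
    and [ext] on the cylinder sigma-algebra. *)
Lemma monX_measurable xs : valid N xs -> measurable_fun setT (fun z => monX xs (c z)).
Proof.
rewrite /monX; elim: xs => [_|a xs IH /= /andP[va /IH vxs]].
  by under eq_fun do rewrite big_nil; exact: measurable_cst.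
under eq_fun do rewrite big_cons.
by apply: measurable_funM => //; exact: mc.
Qed.

Lemma pop_valid i n M : (0 < n <= pop N i M)%N -> inI (N i) n.
Proof. by rewrite /pop /inI; case: (N i) => // /andP[->]. Qed.

Lemma emp_measurable M i (f : test) :
  measurable_fun setT (fun z => emp N M i f (c z)).
Proof.
(* The guard never acts in the sum, but makes each summand measurable for every natural number
   [n]. *)
have E z : emp N M i f (c z) = (pop N i M)%:R^-1 * \sum_(1 <= n < (pop N i M).+1)
    (if inI (N i) n then tval f (c z i n) else 0).
  by congr (_ * _); apply: eq_big_nat => n; rewrite ltnS => /pop_valid ->.
under eq_fun do rewrite E.
apply: measurable_funM; first exact: measurable_cst.
elim: (index_iota _ _) => [|n s IH].
  by under eq_fun do rewrite big_nil; exact: measurable_cst.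
under eq_fun do rewrite big_cons.
apply: measurable_funD => //.
by case: (boolP (inI (N i) n)) => hn; [exact: mc|exact: measurable_cst].
Qed.

Lemma monC_measurable M xs ls : valid N xs ->
  measurable_fun setT (fun z => monC M xs ls (c z)).
Proof.
move=> v; apply: measurable_funM; first exact: monX_measurable.
rewrite /monE; elim: ls => [|b ls IH].
  by under eq_fun do rewrite big_nil; exact: measurable_cst.
under eq_fun do rewrite big_cons.
by apply: measurable_funM => //; exact: emp_measurable.
Qed.

End ConfigurationMeasurability.

Definition mon (xs : seq ('I_C * nat * test)) (ls : seq ('I_C * test)) (w : Om) : R :=
  monX xs (cfg w) * monL ls (Lam w).

Lemma tval_X_measurable (f : test) i n : inI (N i) n ->
  measurable_fun setT (fun w => tval f (X i n w)).
Proof.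
move=> hn; apply: measurable_fun_open => U oU.
apply: (sysX hn (B := tval f (i:=i) @^-1` U)); apply: sub_sigma_algebra.
by have /continuousP := @tval_continuous _ _ _ f i; apply.
Qed.

Lemma ev_measurable (f : test) i : measurable_fun setT (fun w => ev f i (Lam w)).
Proof.
apply: measurable_fun_open => U oU.
apply: (mvX.1 (ev f i @^-1` U)); apply: sub_sigma_algebra.
by have /continuousP := @ev_continuous _ _ _ f i; apply.
Qed.

Lemma ev_finite (f : test) i m w : N i = Some m ->
  ev f i (Lam w) = m%:R^-1 * \sum_(1 <= n < m.+1) tval f (X i n w).
Proof.
move=> Ni; have := mvX.2 i; rewrite Ni => h.
rewrite /ev /integ_map; apply: (@Rintegral_empirical R _ (borelType (S i)) (Lam w i : Prob R (S i)) m
  (fun n => X i n w) (tval f (i:=i))).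
- by move=> B mB; exact: h.
- exact: tval_measurable.
- exact: tval_bdd.
Qed.

(** In a finite class the sequence is constant; in an infinite class this is the defining property
    of the directing measure. As there are finitely many classes, one null set serves for all. *)
Lemma emp_cvg : {ae P, forall w, forall (i : 'I_C) (f : test),
  (fun M => emp N M i f (cfg w)) @ \oo --> ev f i (Lam w)}.
Proof.
have h : forall i, {ae P, forall w, forall f : test,
    (fun M => emp N M i f (cfg w)) @ \oo --> ev f i (Lam w)}.
  move=> i; case Ni: (N i) => [m|].
    apply: aeW => w f; rewrite (ev_finite f w Ni) /emp /pop Ni.
    exact: cvg_cst.
  have := mvX.2 i; rewrite Ni; apply: filterS => w hw f.
  by have := hw (f i); rewrite /emp /pop Ni.
exact: filter_forall h.
Qed.

Lemma monE_cvg ls : {ae P, forall w,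
  (fun M => monE N M ls (cfg w)) @ \oo --> monL ls (Lam w)}.
Proof.
apply: filterS emp_cvg => w h; rewrite /monE /monL; elim: ls => [|b ls IH].
  by rewrite big_nil; under eq_fun do rewrite big_nil; exact: cvg_cst.
rewrite big_cons; under eq_fun do rewrite big_cons.
by apply: cvgM => //; exact: h.
Qed.

Lemma monL_measurable ls : measurable_fun setT (fun w => monL ls (Lam w)).
Proof.
rewrite /monL; elim: ls => [|b ls IH].
  by under eq_fun do rewrite big_nil; exact: measurable_cst.
under eq_fun do rewrite big_cons.
by apply: measurable_funM => //; exact: ev_measurable.
Qed.

Lemma mon_bm xs ls : valid N xs -> bm (mon xs ls).
Proof.
move=> v; split.
  apply: measurable_funM; last exact: monL_measurable.
  by apply: monX_measurable => // f i n; exact: tval_X_measurable.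
have [K hK] := monX_bdd xs; have [L [_ hL]] := monE_bdd N ls.
by exists (K * L) => w; rewrite normrM ler_pM.
Qed.

(** Supplies the base point of the product space, since [Ex_eq_law] is stated over a pointed
    type. *)
Definition sysT : pointedType := HB.pack_for pointedType (sys_space N S)
  (isPointed.Build (sys_space N S) (fun i _ => point : S i)).

Notation cylT := (g_sigma_algebraType (@cyl C N S : set (set sysT))).

(* Coordinates outside the index set take the junk value [point]. *)
Definition ext (x : sys_space N S) : config :=
  fun i n => if insub n is Some k then x i k else point.

Lemma ext_valid (x : sys_space N S) i n (hn : inI (N i) n) :
  ext x i n = x i (exist _ n hn).
Proof. by rewrite /ext (insubT (inI (N i)) hn). Qed.

Lemma ext_measurable (f : test) i n : inI (N i) n ->
  measurable_fun setT (fun x : cylT => tval f (ext x i n)).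
Proof.
move=> hn; apply: measurable_fun_open => U oU; apply: sub_sigma_algebra.
exists i, (exist _ n hn), (tval f (i:=i) @^-1` U); split.
  apply: sub_sigma_algebra.
  by have /continuousP := @tval_continuous _ _ _ f i; apply.
by apply/seteqP; split=> x /=; rewrite ext_valid.
Qed.

Lemma monC_bdd xs ls : exists K, forall M x, `|monC M xs ls x| <= K.
Proof.
have [K hK] := monX_bdd xs; have [L [hL _]] := monE_bdd N ls.
by exists (K * L) => M x; rewrite normrM ler_pM.
Qed.

Lemma eq_monX xs (x y : config) : valid N xs ->
  (forall i n, inI (N i) n -> x i n = y i n) -> monX xs x = monX xs y.
Proof.
rewrite /monX; elim: xs => [_ _|a xs IH /= /andP[va vxs] xy].
  by rewrite !big_nil.
by rewrite !big_cons IH// xy.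
Qed.

Lemma eq_monC M xs ls (x y : config) : valid N xs ->
  (forall i n, inI (N i) n -> x i n = y i n) -> monC M xs ls x = monC M xs ls y.
Proof.
move=> v xy; congr (_ * _); first exact: eq_monX.
apply: eq_bigr => b _; rewrite /emp; congr (_ * _).
by apply: eq_big_nat => n; rewrite ltnS => /pop_valid hn; rewrite xy.
Qed.

Lemma sys_measurable A (sigma : 'I_C -> nat -> nat) :
  (forall i, is_perm_of (N i) (sigma i)) -> @cyl C N S A ->
  measurable [set w | A (fun i k => X i (sigma i (proj1_sig k)) w)].
Proof.
move=> hs [i [[n hn] [B [mB ->]]]].
by apply: (sysX _ mB) => /=; have [h _ _ _] := hs i; exact: h.
Qed.

(** A valid [monC] reads only coordinates in the index sets, so it factors through [sys_space] as a
    cylinder-measurable function, to which equality of laws applies. *)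
Lemma Ex_exch (sigma : 'I_C -> nat -> nat) M xs ls :
  (forall i, is_perm_of (N i) (sigma i)) -> valid N xs ->
  (\int[P]_w monC M xs ls (fun i n => X i (sigma i n) w) =
   \int[P]_w monC M xs ls (cfg w))%R.
Proof.
move=> hs v.
pose U (w : Om) : cylT := fun i k => X i (sigma i (proj1_sig k)) w.
pose V (w : Om) : cylT := fun i k => X i (proj1_sig k) w.
have hid : forall i, is_perm_of (N i) id.
  move=> i; split=> //; first by move=> m hm; exists m.
  by exists 0%N.
have [K hK] := monC_bdd xs ls.
have := @Ex_eq_law _ _ _ P _ _ U V (fun x => monC M xs ls (ext x)).
have -> : (\int[P]_w monC M xs ls (ext (U w)) =
    \int[P]_w monC M xs ls (fun i n => X i (sigma i n) w))%R.
  by apply: eq_Rintegral => w _; apply: eq_monC => // i n hn; rewrite ext_valid.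
have -> : (\int[P]_w monC M xs ls (ext (V w)) =
    \int[P]_w monC M xs ls (cfg w))%R.
  by apply: eq_Rintegral => w _; apply: eq_monC => // i n hn; rewrite ext_valid.
apply.
- by move=> A hA; exact: (sys_measurable hs hA).
- by move=> A hA; exact: (sys_measurable hid hA).
- by move=> A hA; exact: (exchX hs hA).
- by apply: monC_measurable => // f i n; exact: ext_measurable.
- by exists K.
Qed.

Lemma Ex_monC_cvg xs ls : valid N xs ->
  (fun M => \int[P]_w monC M xs ls (cfg w))%R @ \oo --> (\int[P]_w mon xs ls w)%R.
Proof.
move=> v; have [K hK] := monC_bdd xs ls.
apply: (@Ex_dct _ _ _ _ _ _ K) => //.
- by move=> M; apply: monC_measurable => // f i n; exact: tval_X_measurable.
- by have [] := mon_bm ls v.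
- apply: filterS (monE_cvg ls) => w hw.
  by apply: cvgM => //; exact: cvg_cst.
Qed.

Definition fresh (i : 'I_C) (n : nat) (xs : seq ('I_C * nat * test)) : bool :=
  ~~ has (fun a => a.1 == (i, n)) xs.

Lemma fresh_large i n xs : (\max_(a <- xs) a.1.2 < n)%N -> fresh i n xs.
Proof.
rewrite /fresh; elim: xs => [//|[[j p] h] xs IH].
rewrite big_cons gtn_max /= negb_or => /andP[pn /IH ->]; rewrite andbT.
by apply/eqP => -[_ e1]; move: pn; rewrite e1 ltnn.
Qed.

(** Exchangeability is applied to [monC], with [M] so large that transposing [k] and [n] leaves all
    empirical means unchanged; then M tends to infinity. *)
Lemma Ex_swap i k n g xs ls : valid N xs -> inI (N i) k -> inI (N i) n ->
  fresh i k xs -> fresh i n xs ->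
  (\int[P]_w mon ((i, k, g) :: xs) ls w = \int[P]_w mon ((i, n, g) :: xs) ls w)%R.
Proof.
move=> v hk hn fk fn.
have vk : valid N ((i, k, g) :: xs) by rewrite /= hk.
have vn : valid N ((i, n, g) :: xs) by rewrite /= hn.
have ck := @Ex_monC_cvg _ ls vk; have cn := @Ex_monC_cvg _ ls vn.
suff e : \forall M \near \oo, (\int[P]_w monC M ((i, k, g) :: xs) ls (cfg w) =
    \int[P]_w monC M ((i, n, g) :: xs) ls (cfg w))%R.
  apply: (@cvg_unique _ _ _ _ _ _ ck) => //.
  by apply: cvg_trans cn; apply: near_eq_cvg; apply: filterS e => M ->.
pose sigma (j : 'I_C) : nat -> nat := if j == i then swap k n else id.
have hs j : is_perm_of (N j) (sigma j).
  rewrite /sigma; case: eqP => [->|_]; first exact: swap_perm_of.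
  split=> //; first by move=> m hm; exists m.
  by exists 0%N.
near=> M.
rewrite -(Ex_exch M ls hs vk); apply: eq_Rintegral => w _.
congr (_ * _).
  rewrite /monX !big_cons /=; congr (_ * _).
    by rewrite /sigma eqxx /swap eqxx.
  (* By freshness of [k] and [n], the transposition fixes every coordinate occurring in [xs]. *)
  elim: xs {v vk vn ck cn} fk fn => [_ _|a xs IH]; first by rewrite !big_nil.
  rewrite /fresh /= !negb_or => /andP[ak fk] /andP[an fn].
  rewrite !big_cons (IH fk fn); congr (_ * _); congr (tval _ _); congr (X _ _ _).
  rewrite /sigma; case: eqP => // ai.
  rewrite /swap; case: eqP => [ek|_].
    by move: ak; rewrite -ai -ek -surjective_pairing eqxx.
  by case: eqP => [en|//]; move: an; rewrite -ai -en -surjective_pairing eqxx.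
(* In class [i] the transposition only permutes the averaged coordinates, as both [k] and [n] are
   among them. *)
apply: eq_bigr => b _; rewrite /emp; congr (_ * _).
rewrite /sigma; case: (eqVneq b.1 i) => [bi|//].
apply: (sum_swap (fun m => tval b.2 (X b.1 m w))).
  rewrite bi /pop; move: hk; rewrite /inI; case: (N i) => // /andP[-> _] /=.
  by near: M; exists k.
rewrite bi /pop; move: hn; rewrite /inI; case: (N i) => // /andP[-> _] /=.
by near: M; exists n.
Unshelve. all: by end_near. Qed.

Lemma mon_cons_X i n g xs ls w :
  mon ((i, n, g) :: xs) ls w = tval g (X i n w) * mon xs ls w.
Proof. by rewrite /mon /monX big_cons mulrA. Qed.

Lemma mon_cons_L i g xs ls w :
  mon xs ((i, g) :: ls) w = ev g i (Lam w) * mon xs ls w.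
Proof. by rewrite /mon /monL big_cons mulrCA. Qed.

Lemma Ex_finite i m g xs ls : N i = Some m -> valid N xs ->
  (\int[P]_w mon xs ((i, g) :: ls) w =
   m%:R^-1 * \sum_(1 <= n < m.+1) \int[P]_w mon ((i, n, g) :: xs) ls w)%R.
Proof.
move=> Ni v.
(* The value 0 off the index set makes every term bounded and measurable, as [Ex_sum] demands. *)
pose F n w := if inI (N i) n then mon ((i, n, g) :: xs) ls w else 0.
have bF n : bm (F n).
  rewrite /F; case: (boolP (inI (N i) n)) => hn; last exact: bm_cst.
  by apply: mon_bm; rewrite /= hn.
have FE n w : (0 < n < m.+1)%N -> F n w = mon ((i, n, g) :: xs) ls w.
  by rewrite /F Ni /inI ltnS => ->.
rewrite [RHS](_ : _ = m%:R^-1 * \sum_(1 <= n < m.+1) \int[P]_w F n w)%R; last first.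
  congr (_ * _); apply: eq_big_nat => n hn.
  by apply: eq_Rintegral => w _; rewrite FE.
rewrite -Ex_sum// -ExZ; last exact: bm_sum.
apply: eq_Rintegral => w _.
rewrite mon_cons_L (ev_finite g w Ni) -mulrA; congr (_ * _).
rewrite mulr_suml; apply: eq_big_nat => n hn.
by rewrite FE// mon_cons_X.
Qed.

Lemma Ex_infinite i k g xs ls : N i = None -> valid N xs -> inI (N i) k ->
  fresh i k xs ->
  (\int[P]_w mon ((i, k, g) :: xs) ls w = \int[P]_w mon xs ((i, g) :: ls) w)%R.
Proof.
move=> Ni v hk fk.
have vn n : valid N ((i, n.+1, g) :: xs) by rewrite /= Ni.
pose u n := (\int[P]_w mon ((i, n.+1, g) :: xs) ls w)%R.
(* Indices beyond all those in [xs] are fresh, so [u] is eventually constant by [Ex_swap]; taking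
   Cesaro means keeps the limit. *)
have cu : u @ \oo --> (\int[P]_w mon ((i, k, g) :: xs) ls w)%R.
  apply/cvgrPdist_le => e e0.
  near=> n; rewrite /u (@Ex_swap i k n.+1)// ?Ni// ?subrr ?normr0 ?ltW//.
  apply: fresh_large; rewrite ltnS; near: n.
  by exists (\max_(a <- xs) a.1.2)%N.
have c1 := cesaro cu.
have c2 : arithmetic_mean u @ \oo --> (\int[P]_w mon xs ((i, g) :: ls) w)%R.
  have [K [K0 gK]] := bddP (tval_bdd g i).
  have [_ [L hL]] := mon_bm ls v.
  (* The mean of index [M] has [M.+1] terms, belonging to the coordinates 1 to [M.+1]. *)
  rewrite (_ : arithmetic_mean u = fun M =>
      (\int[P]_w (emp N M.+1 i g (cfg w) * mon xs ls w))%R); last first.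
    apply/funext => M; rewrite /arithmetic_mean /series /= /u.
    rewrite -Ex_sum; last by move=> n; exact: mon_bm.
    rewrite -ExZ; last by apply: bm_sum => n; exact: mon_bm.
    apply: eq_Rintegral => w _; rewrite /emp /pop Ni -mulrA; congr (_ * _).
    rewrite big_add1/= mulr_suml; apply: eq_bigr => n _.
    by rewrite mon_cons_X.
  apply: (@Ex_dct _ _ _ _ _ _ (K * L)).
  - move=> M; apply: measurable_funM; last by have [] := mon_bm ls v.
    by apply: emp_measurable => f j n; exact: tval_X_measurable.
  - by have [] := mon_bm ((i, g) :: ls) v.
  - by move=> M w; rewrite normrM ler_pM//; apply: emp_bound => //; exact: ltW.
  - apply: filterS emp_cvg => w hw; rewrite mon_cons_L.
    apply: cvgM; last exact: cvg_cst.
    by have := hw i g; rewrite -cvg_shiftS.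
exact: (@cvg_unique _ _ _ _ _ _ c1).
Unshelve. all: by end_near. Qed.

End System.

(** * Transfer of convergence between the two kinds of moments *)

Section Transfer.
Context (R : realType) (C : nat) (N : 'I_C -> option nat)
  (S : 'I_C -> ptopologicalType)
  (d : option R -> measure_display) (Om : forall r, measurableType (d r))
  (P : forall r, probability (Om r) R)
  (X : forall r (i : 'I_C), nat -> Om r -> S i)
  (Lam : forall r, Om r -> mvec_space R S).
Arguments X : clear implicits.
Arguments Lam : clear implicits.
Hypothesis hN : forall i m, N i = Some m -> (1 <= m)%N.
Hypothesis hX : forall r, Rplus_oo r ->
  is_system N (X r) /\ multi_exchangeable N (P r) (X r).
Hypothesis hLam : forall r, Rplus_oo r -> is_measure_vector N (P r) (X r) (Lam r).

Notation test := (test R S).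
Implicit Types (xs : seq ('I_C * nat * test)) (ls : seq ('I_C * test)).

Definition mon_cvg xs ls : Prop := cvgE P (fun r => mon (X r) (Lam r) xs ls).

Lemma bm_mon_family xs ls : valid N xs -> bm_family (fun r => mon (X r) (Lam r) xs ls).
Proof.
move=> v r r0; have [sysX _] := hX r0.
exact: (mon_bm sysX (hLam r0)).
Qed.

(** Extends by 0 a family controlled only under the condition [b], so that sums can run over all
    indices. *)
Definition masked (b : bool) (g : forall r, Om r -> R) (r : option R) (w : Om r) : R :=
  if b then g r w else 0.

Lemma masked_bm (b : bool) (g : forall r, Om r -> R) : (b -> bm_family g) -> bm_family (masked b g).
Proof. by case: b => [/(_ isT)//|_ r _]; exact: bm_cst. Qed.

Lemma masked_cvg (b : bool) (g : forall r, Om r -> R) : (b -> cvgE P g) -> cvgE P (masked b g).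
Proof. by case: b => [/(_ isT)//|_]; exact: cvgE_cst. Qed.

(** Induction on the number of coordinate factors, for all [ls] at once: a repeated coordinate is
    merged, and a fresh one is traded for an integral against the measure vector. *)
Lemma mon_cvg_measures : (forall ls, mon_cvg [::] ls) ->
  forall xs ls, valid N xs -> mon_cvg xs ls.
Proof.
move=> H xs; have [n] := ubnP (size xs).
elim: n xs => // n IH [|[[i k] g] xs]; first by move=> _ ls _; exact: H.
rewrite /= ltnS => sn ls /andP[hk v].
have [hh|fk] := boolP (has (fun a => a.1 == (i, k)) xs).
  have [xs' [v' s' m']] := monX_merge g v hh.
  apply: (@eq_cvgE _ _ _ _ (fun r => mon (X r) (Lam r) xs' ls)).
    by move=> r _; apply: eq_Rintegral => w _; rewrite /mon m'.
  by apply: IH => //; rewrite s'.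
case Ni: (N i) => [m|]; last first.
  apply: (@eq_cvgE _ _ _ _ (fun r => mon (X r) (Lam r) xs ((i, g) :: ls))).
    move=> r r0; have [sysX exchX] := hX r0.
    by rewrite (Ex_infinite sysX exchX (hLam r0) g ls Ni v hk).
  exact: IH.
(* The number of fresh coordinates in the finite class, at least 1 because [k] is one of them; all
   of them contribute equally. *)
pose c := count (fun p => fresh i p xs) (index_iota 1 m.+1).
have kin : k \in index_iota 1 m.+1.
  by move: hk; rewrite Ni /inI mem_index_iota ltnS.
have c0 : c%:R != 0 :> R.
  by rewrite pnatr_eq0 -lt0n -has_count; apply/hasP; exists k.
(* For a coordinate already used, the new factor merges into [xs], so the induction hypothesis
   covers these terms. *)
pose b p := inI (N i) p && ~~ fresh i p xs.
pose G p := masked (b p) (fun r => mon (X r) (Lam r) ((i, p, g) :: xs) ls).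
have bG p : bm_family (G p).
  by apply: masked_bm => /andP[hp _]; apply: bm_mon_family; rewrite /= hp.
have cG p : cvgE P (G p).
  apply: masked_cvg => /andP[hp]; rewrite negbK => hh.
  have [xs' [v' s' m']] := monX_merge g v hh.
  apply: (@eq_cvgE _ _ _ _ (fun r => mon (X r) (Lam r) xs' ls)).
    by move=> r _; apply: eq_Rintegral => w _; rewrite /mon m'.
  by apply: IH => //; rewrite s'.
have bg : bm_family (fun r => mon (X r) (Lam r) xs ((i, g) :: ls)).
  exact: bm_mon_family.
have bS : bm_family (fun r w => \sum_(p <- index_iota 1 m.+1) G p r w).
  by move=> r r0; apply: bm_sum => p; exact: bG.
(* This is the expansion of the empirical mean solved for the term with [k]: m times the moment with
   the integral equals c times the wanted moment plus the terms with used coordinates. *)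
apply: (@eq_cvgE _ _ _ _ (fun r w => c%:R^-1 * (m%:R * mon (X r) (Lam r) xs ((i, g) :: ls) w
   + -1 * \sum_(p <- index_iota 1 m.+1) G p r w))); last first.
  apply: cvgE_scale.
    by move=> r r0; apply: bmD; apply: bmZ; [exact: bg|exact: bS].
  apply: cvgE_add.
  - by move=> r r0; apply: bmZ; exact: bg.
  - by move=> r r0; apply: bmZ; exact: bS.
  - by apply: cvgE_scale => //; exact: IH.
  - by apply: cvgE_scale => //; exact: cvgE_sum.
move=> r r0; have [sysX exchX] := hX r0.
rewrite ExZ; last by apply: bmD; apply: bmZ; [exact: bg|exact: bS].
rewrite ExD; [|by apply: bmZ; exact: bg|by apply: bmZ; exact: bS].
rewrite ExZ; last exact: bg.
rewrite ExZ; last exact: bS.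
rewrite Ex_sum; last by move=> p; exact: bG.
rewrite (Ex_finite sysX (hLam r0) g ls Ni v) mulrA mulfV ?mul1r; last first.
  by rewrite pnatr_eq0 -lt0n; exact: hN Ni.
apply: (mulfI c0); rewrite mulrA mulfV// mul1r.
have -> : c%:R * (\int[P r]_w mon (X r) (Lam r) ((i, k, g) :: xs) ls w)%R =
   \sum_(p <- index_iota 1 m.+1) if fresh i p xs then
     (\int[P r]_w mon (X r) (Lam r) ((i, k, g) :: xs) ls w)%R else 0.
  by rewrite -big_mkcond/= big_const_seq iter_addr_0 mulr_natl.
rewrite mulN1r -sumrB; apply: eq_big_nat => p hp.
have vp : inI (N i) p by rewrite Ni /inI.
rewrite /G /masked /b vp; case: (boolP (fresh i p xs)) => hf /=.
  by rewrite Ex_cst subr0 (Ex_swap sysX exchX (hLam r0) g ls v hk vp fk hf).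
by rewrite subrr.
Qed.

(** Induction on the number of integrals, for all [xs] at once: an integral becomes a factor at a
    fresh coordinate in an infinite class, and a mean over all coordinates in a finite one. *)
Lemma mon_cvg_systems : (forall xs, valid N xs -> mon_cvg xs [::]) ->
  forall ls xs, valid N xs -> mon_cvg xs ls.
Proof.
move=> H; elim=> [//|[i g] ls IH] xs v.
case Ni: (N i) => [m|]; last first.
  pose k := (\max_(a <- xs) a.1.2).+1.
  have hk : inI (N i) k by rewrite Ni.
  have fk : fresh i k xs by exact: fresh_large.
  apply: (@eq_cvgE _ _ _ _ (fun r => mon (X r) (Lam r) ((i, k, g) :: xs) ls)).
    move=> r r0; have [sysX exchX] := hX r0.
    by rewrite (Ex_infinite sysX exchX (hLam r0) g ls Ni v hk).
  by apply: IH; rewrite /= hk.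
pose G p := masked (inI (N i) p) (fun r => mon (X r) (Lam r) ((i, p, g) :: xs) ls).
have bG p : bm_family (G p).
  by apply: masked_bm => hp; apply: bm_mon_family; rewrite /= hp.
have cG p : cvgE P (G p).
  by apply: masked_cvg => hp; apply: IH; rewrite /= hp.
have bS : bm_family (fun r w => \sum_(p <- index_iota 1 m.+1) G p r w).
  by move=> r r0; apply: bm_sum => p; exact: bG.
apply: (@eq_cvgE _ _ _ _ (fun r w => m%:R^-1 * \sum_(p <- index_iota 1 m.+1) G p r w)).
  move=> r r0; have [sysX exchX] := hX r0.
  rewrite ExZ; last exact: bS.
  rewrite Ex_sum; last by move=> p; exact: bG.
  rewrite (Ex_finite sysX (hLam r0) g ls Ni v); congr (_ * _).
  by apply: eq_big_nat => p hp; rewrite /G /masked Ni /inI hp.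
by apply: cvgE_scale => //; exact: cvgE_sum.
Qed.

End Transfer.

(** * Generating families of the product and weak topologies *)

Section GeneratedFilter.
Context (R : realType) (T : Type) (J : countType) (a : J -> T -> R).

(** The neighbourhood filter of the initial topology for [a]. That [a] generates the topology means
    that this filter converges to [x], which can be tested coordinatewise in a product. *)
Definition initial_nbhs (x : T) : set_system T := [set U |
  exists (l : seq J) (e : R), 0 < e /\
    forall y, (forall j, j \in l -> `|a j y - a j x| < e) -> U y].

Lemma initial_nbhs_filter x : Filter (initial_nbhs x).
Proof.
split.
- by exists [::], 1.
- move=> U V [l [e [e0 lU]]] [k [f [f0 kV]]].
  exists (l ++ k), (Num.min e f); split; first by rewrite lt_min e0.
  move=> y h; split.
    by apply: lU => j jl; have := h j; rewrite mem_cat jl lt_min => /(_ isT)/andP[].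
  by apply: kV => j jl; have := h j; rewrite mem_cat jl orbT lt_min => /(_ isT)/andP[].
- by move=> U V UV [l [e [e0 lU]]]; exists l, e; split=> // y /lU/UV.
Qed.

End GeneratedFilter.
#[local] Existing Instance initial_nbhs_filter.

Lemma prod_topology_cvg (I : Type) (T : I -> topologicalType)
    (F : set_system (prod_topology T)) (x : prod_topology T) : Filter F ->
  (forall i (V : set (T i)), nbhs (x i) V -> F [set y | V (y i)]) -> F --> x.
Proof.
move=> FF h; apply/cvg_sup => i A /= [B [[V oV <-] Vx] VA].
by apply: filterS VA _; apply: h; exact: open_nbhs_nbhs.
Qed.

Lemma initial_topology_cvg (S : choiceType) (T : topologicalType) (f : S -> T)
    (F : set_system S) (x : S) : Filter F ->
  (forall V : set T, nbhs (f x) V -> F (f @^-1` V)) ->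
  F --> (x : initial_topology f).
Proof.
move=> FF h A /= [B [[V oV <-] Vx] VA].
by apply: filterS VA _; apply: h; exact: open_nbhs_nbhs.
Qed.

(** Ensures that spikes built on bounded continuous functions, and their maxima, are again
    admissible test functions for weak convergence. *)
Lemma continuous_bounded_ua (R : realType) (T : topologicalType) :
  uniform_algebra (fun f : T -> R => continuous f /\ bounded_by_some f).
Proof.
split.
- by move=> f [].
- by move=> c; split; [move=> x; exact: cvg_cst|exact: bdd_cst].
- by move=> f g [cf bf] [cg bg]; split; [move=> x; apply: cvgD; [exact: cf|exact: cg]|exact: bddD].
- by move=> f g [cf bf] [cg bg]; split; [move=> x; apply: cvgM; [exact: cf|exact: cg]|exact: bddM].
- move=> f fg; split; last by apply: bdd_unif => e /fg[g [_ bg] h]; exists g.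
  move=> x; apply/cvgrPdist_le => e e0.
  have e3 : 0 < e / 3 by rewrite divr_gt0.
  have [g [cg _] h] := fg _ e3.
  have /cvgrPdist_le /(_ _ e3) gx := cg x.
  near=> y.
  have gy : `|g x - g y| <= e / 3 by near: y.
  move: (h x) (h y) gy; rewrite !ler_norml => /andP[? ?] /andP[? ?] /andP[? ?].
  by apply/andP; split; lra.
Unshelve. all: by end_near. Qed.

Lemma spike_continuous_bounded (R : realType) (T : topologicalType)
    (a : nat -> bcfun R T) k :
  continuous (spike (fun j => proj1_sig (a j)) k) /\
  bounded_by_some (spike (fun j => proj1_sig (a j)) k).
Proof.
apply: (ua_spike k (continuous_bounded_ua R T)) => j.
exact: (proj2_sig (a j)).
Qed.

Lemma maxs_continuous_bounded (R : realType) (T : topologicalType)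
    (a : nat -> bcfun R T) s :
  continuous (maxs (spike (fun j => proj1_sig (a j))) s) /\
  bounded_by_some (maxs (spike (fun j => proj1_sig (a j))) s).
Proof.
apply: (ua_bigmax (continuous_bounded_ua R T)) => k.
exact: spike_continuous_bounded.
Qed.

(** The family consists of the distances to the points of a dense sequence, truncated at 1 to be
    bounded. *)
Lemma polish_generates (R : realType) (T : ptopologicalType) : polish R T ->
  exists a : nat -> bcfun R T, generates (fun j => proj1_sig (a j)).
Proof.
move=> [[D [cD clD]] [dist [[d0 d_eq dC dT] [nbhsd _]]]].
have [q qD] : exists q : nat -> T, D `<=` range q.
  have /pfcard_geP[->|[f]] := cD; first by exists (fun=> point).
  by exists f => x /(@surj _ _ _ _ f)[n _ <-]; exists n.
pose f j x := Num.min 1 (dist x (q j)).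
have fc j : continuous (f j).
  move=> x; apply/cvgrPdist_lt => e e0; apply/nbhsd.
  exists e; split=> // y /= xy; apply: le_lt_trans xy.
  rewrite /f; have h1 := dT x y (q j); have h2 := dT y x (q j).
  rewrite (dC y x) in h2; have h3 := d0 x y.
  by rewrite ler_norml; case: (leP 1 (dist x (q j))); case: (leP 1 (dist y (q j)));
    move=> *; apply/andP; split; lra.
have fb j : exists M : R, forall x, `|f j x| <= M.
  exists 1 => x; rewrite /f ger0_norm ?ge_min ?lexx//.
  by rewrite le_min ler01 d0.
exists (fun j => exist _ (f j) (conj (@fc j) (fb j))).
move=> x U /nbhsd[e [e0 eU]] /=.
(* With y = [q j] within [e1] of [x], the condition on [z] bounds the truncated distance from z to y
   by 2 [e1], below 1, so the truncation is inactive there and x, z are less than 3 [e1] apart. *)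
pose e1 := Num.min e 1 / 4.
have e10 : 0 < e1 by rewrite divr_gt0// lt_min e0 ltr01.
have e1e : 4 * e1 <= e by rewrite mulrC divfK ?ge_min ?lexx.
have e11 : 4 * e1 <= 1 by rewrite mulrC divfK ?ge_min ?lexx ?orbT.
have [y [Dy xy]] : D `&` [set y | dist x y < e1] !=set0.
  have : closure D x by rewrite clD.
  by move=> h; apply: h; apply/nbhsd; exists e1; split.
have [j _ jy] := qD _ Dy.
exists [:: j], e1; split=> // z /(_ j (mem_head _ _)).
rewrite /f jy => h; apply: eU => /=; apply: le_lt_trans (dT x y z) _.
move: h; rewrite /= in xy; have := d0 z y; rewrite (dC y z) ltr_norml => zy /andP[_].
by case: (leP 1 (dist x y)); case: (leP 1 (dist z y)); move=> *; lra.
Qed.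

(** * Countably many integrals determining the weak topology *)

Section WeakTopology.
Context (R : realType) (T : ptopologicalType) (a : nat -> bcfun R T).
Hypothesis ga : generates (fun j => proj1_sig (a j)).

Definition bcmax (s : seq (rat * nat * seq (nat * rat))) : bcfun R T :=
  exist _ _ (maxs_continuous_bounded a s).

Lemma bm_bcfun (f : bcfun R T) : bm (proj1_sig f : borelType T -> R).
Proof.
case: f => f [cf bf] /=; split=> //; apply: measurable_fun_open => U oU.
by apply: sub_sigma_algebra; move/continuousP : cf; apply.
Qed.

(** A maximum of spikes below [f] loses at most [e] of the integral against [mu]; passing from [mu]
    to [nu] loses another [e]. Here [mu] is treated as the law of the identity map. *)
Lemma weak_lower (f : bcfun R T) (mu : Prob R T) (e : R) :
  (forall x, 0 <= proj1_sig f x) -> 0 < e -> exists s, forall nu : Prob R T,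
  `|integ_map nu (bcmax s) - integ_map mu (bcmax s)| < e ->
  integ_map mu f - 2 * e <= integ_map nu f.
Proof.
move=> f0 e0; have bf := bm_bcfun f.
have [cf bbf] := proj2_sig f.
have mphi k : measurable_fun setT
    (spike (fun j => proj1_sig (a j)) k \o (id : borelType T -> T)).
  by have [] := bm_bcfun (exist _ _ (spike_continuous_bounded a k)).
have [s [sf hs]] := Ex_lower_approx (spike_lower_dense ga) mu mphi cf f0 bbf e0.
exists s => nu; rewrite ltr_norml => /andP[h _].
have h1 : integ_map nu (bcmax s) <= integ_map nu f.
  by apply: Ex_le; [exact: bm_bcfun|exact: bm_bcfun|exact: sf].
have h2 : integ_map mu f - e <= integ_map mu (bcmax s) by exact: hs.
lra.
Qed.

(** The lower estimate is applied to M + f and M - f. Tolerance e / 4 yields a two-sided error of at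
    most e / 2, hence the strict bound. *)
Lemma weak_approx (f : bcfun R T) (mu : Prob R T) (e : R) : 0 < e ->
  exists s t (e' : R), 0 < e' /\ forall nu : Prob R T,
  `|integ_map nu (bcmax s) - integ_map mu (bcmax s)| < e' ->
  `|integ_map nu (bcmax t) - integ_map mu (bcmax t)| < e' ->
  `|integ_map nu f - integ_map mu f| < e.
Proof.
move=> e0; have e4 : 0 < e / 4 by rewrite divr_gt0.
have ua := continuous_bounded_ua R T.
have [M fM] := (proj2_sig f).2.
have h1 : continuous (fun x => M + proj1_sig f x) /\
    bounded_by_some (fun x => M + proj1_sig f x).
  by apply: (ua_add ua); [exact: (ua_cst ua)|exact: (proj2_sig f)].
have h2 : continuous (fun x => M + -1 * proj1_sig f x) /\
    bounded_by_some (fun x => M + -1 * proj1_sig f x).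
  apply: (ua_add ua); first exact: (ua_cst ua).
  by apply: (ua_scale ua); exact: (proj2_sig f).
have f1 x : 0 <= M + proj1_sig f x by have := fM x; rewrite ler_norml => /andP[? ?]; lra.
have f2 x : 0 <= M + -1 * proj1_sig f x by have := fM x; rewrite ler_norml => /andP[? ?]; lra.
have [s hs] := @weak_lower (exist _ _ h1) mu _ f1 e4.
have [t ht] := @weak_lower (exist _ _ h2) mu _ f2 e4.
have E1 (nu : Prob R T) : integ_map nu (exist _ _ h1) = M + integ_map nu f.
  by rewrite /integ_map /= ExD ?Ex_cst//; [exact: bm_cst|exact: bm_bcfun].
have E2 (nu : Prob R T) : integ_map nu (exist _ _ h2) = M + -1 * integ_map nu f.
  rewrite /integ_map /= ExD ?Ex_cst ?ExZ//; [exact: bm_bcfun|exact: bm_cst|].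
  by apply: bmZ; exact: bm_bcfun.
exists s, t, (e / 4); split=> // nu /hs + /ht.
rewrite !E1 !E2 => ? ?; rewrite ltr_norml; apply/andP; split; lra.
Qed.

End WeakTopology.

Lemma continuous_mul (R : realType) (T : topologicalType) (f g : T -> R) :
  continuous f -> continuous g -> continuous (fun x => f x * g x).
Proof. by move=> cf cg x; apply: cvgM; [exact: cf|exact: cg]. Qed.

Section GeneratingFamilies.
Context (R : realType) (C : nat) (N : 'I_C -> option nat)
  (S : 'I_C -> ptopologicalType) (a : forall i, nat -> bcfun R (S i)).
Hypothesis ga : forall i, generates (fun j => proj1_sig (a i j)).

Definition atom (j : nat) : test R S := fun i => a i j.

(** The constant 1 off the index sets keeps the index type free of membership proofs; such factors
    drop out of products. *)
Definition sys_family (p : 'I_C * nat * nat) (x : sys_space N S) : R :=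
  if inI (N p.1.1) p.1.2 then tval (atom p.2) (ext x p.1.1 p.1.2) else 1.

Lemma sys_family_generates : generates sys_family.
Proof.
move=> x; suff : initial_nbhs sys_family x --> x by move=> h U /h.
apply: prod_topology_cvg => i V nV.
have FF : Filter (fmap (fun z : sys_space N S => z i) (initial_nbhs sys_family x)).
  exact: fmap_filter.
apply: (@prod_topology_cvg _ _ (fmap (fun z : sys_space N S => z i)
  (initial_nbhs sys_family x)) (x i) FF _ V nV) => -[n hn] W nW.
have [l [e [e0 lW]]] := ga nW.
exists [seq (i, n, j) | j <- l], e; split=> // y h; apply: lW => j jl.
have := h (i, n, j) (map_f _ jl).
by rewrite /sys_family /= hn !(ext_valid _ hn).
Qed.

Lemma ext_continuous (f : test R S) i n : inI (N i) n ->
  continuous (fun x : sys_space N S => tval f (ext x i n)).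
Proof.
move=> hn x.
rewrite (_ : (fun _ => _) = fun y : sys_space N S => tval f (y i (exist _ n hn))); last first.
  by apply/funext => y; rewrite ext_valid.
have h1 := @prod_proj_continuous _ (fun i : 'I_C =>
    (prod_topology (fun _ : {n : nat | inI (N i) n} => S i) : topologicalType)) i x.
have h2 := @prod_proj_continuous _ (fun _ : {n : nat | inI (N i) n} => (S i : topologicalType))
  (exist _ n hn) (x i).
have h3 := @tval_continuous _ _ _ f i (x i (exist _ n hn)).
by move=> A nA; exact: h1 _ (h2 _ (h3 A nA)).
Qed.

Lemma monX_continuous (xs : seq ('I_C * nat * test R S)) : valid N xs ->
  continuous (fun x : sys_space N S => monX xs (ext x)).
Proof.
elim: xs => [_|b xs IH /= /andP[vb /IH cxs]].
  rewrite (_ : (fun _ => _) = fun=> 1); first exact: cst_continuous.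
  by apply/funext => x; rewrite /monX big_nil.
rewrite (_ : (fun _ => _) = fun x : sys_space N S =>
    tval b.2 (ext x b.1.1 b.1.2) * monX xs (ext x)).
  by apply: continuous_mul; [exact: (@ext_continuous b.2 _ _ vb)|exact: cxs].
by apply/funext => x; rewrite /monX big_cons.
Qed.

Lemma monL_continuous (ls : seq ('I_C * test R S)) :
  continuous (@monL R C S ls).
Proof.
elim: ls => [|b ls IH].
  rewrite (_ : monL _ = fun=> 1); first exact: cst_continuous.
  by apply/funext => mu; rewrite /monL big_nil.
rewrite (_ : monL _ = fun mu => ev b.2 b.1 mu * monL ls mu).
  by apply: continuous_mul; [exact: ev_continuous|exact: IH].
by apply/funext => mu; rewrite /monL big_cons.
Qed.

Lemma prod_sys_family s (x : sys_space N S) : \prod_(p <- s) sys_family p x =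
  monX [seq (p.1, atom p.2) | p <- s & inI (N p.1.1) p.1.2] (ext x).
Proof. by rewrite /monX big_map big_filter [RHS]big_mkcond. Qed.

Definition measure_family (p : 'I_C * seq (rat * nat * seq (nat * rat)))
    (mu : mvec_space R S) : R :=
  ev (fun i => bcmax (a i) p.2) p.1 mu.

Lemma measure_family_generates : generates measure_family.
Proof.
move=> mu; suff : initial_nbhs measure_family mu --> mu by move=> h U /h.
apply: prod_topology_cvg => i V nV.
have FF : Filter (fmap (fun nu : mvec_space R S => nu i) (initial_nbhs measure_family mu)).
  exact: fmap_filter.
apply: (@initial_topology_cvg _ _ (@integ_map R (S i)) (fmap (fun nu : mvec_space R S => nu i)
  (initial_nbhs measure_family mu)) (mu i) FF _ V nV) => W nW.
have GG : Filter (fmap (@integ_map R (S i) \o (fun nu : mvec_space R S => nu i))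
   (initial_nbhs measure_family mu)) by exact: fmap_filter.
apply: (@prod_topology_cvg _ _ (fmap (@integ_map R (S i) \o (fun nu : mvec_space R S => nu i))
  (initial_nbhs measure_family mu)) _ GG _ W nW) => f B /nbhs_ballP[e /= e0 eB].
have [s [t [e' [e'0 st]]]] := weak_approx (ga (i := i)) f (mu i) e0.
exists [:: (i, s); (i, t)], e'; split=> // nu h; apply: eB.
rewrite /ball /= distrC; apply: st.
- by apply: (h (i, s)); rewrite mem_head.
- by apply: (h (i, t)); rewrite !inE eqxx orbT.
Qed.

Lemma prod_measure_family s (mu : mvec_space R S) : \prod_(p <- s) measure_family p mu =
  monL [seq (p.1, (fun i => bcmax (a i) p.2) : test R S) | p <- s] mu.
Proof. by rewrite /monL big_map. Qed.

End GeneratingFamilies.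

(** * Equivalence of the two convergences in law *)

Theorem theorem4 (R : realType) (C : nat) (hC : (1 <= C)%N)
  (N : 'I_C -> option nat) (hN : forall i m, N i = Some m -> (1 <= m)%N)
  (S : 'I_C -> ptopologicalType) (hS : forall i, polish R (S i))
  (d : option R -> measure_display) (Om : forall r, measurableType (d r))
  (P : forall r, probability (Om r) R)
  (X : forall r (i : 'I_C), nat -> Om r -> S i)
  (Lam : forall r, Om r -> mvec_space R S)
  (hX : forall r, Rplus_oo r -> is_system N (X r) /\ multi_exchangeable N (P r) (X r))
  (hLam : forall r, Rplus_oo r -> is_measure_vector N (P r) (X r) (Lam r)) :
  cvg_in_law P (fun r => sys (N:=N) (X r)) <-> cvg_in_law P Lam.
Proof.
have [a ga] : exists a : forall i, nat -> bcfun R (S i),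
    forall i, generates (fun j => proj1_sig (a i j)).
  have h i : {a : nat -> bcfun R (S i) | generates (fun j => proj1_sig (a j))}.
    by apply: cid; exact: polish_generates.
  by exists (fun i => sval (h i)) => i; exact: svalP (h i).
split=> cvgY.
(* A valid coordinate monomial is a bounded continuous function of the system, so its expectations
   converge by assumption. *)
- have cX (xs : seq ('I_C * nat * test R S)) : valid N xs -> mon_cvg P X Lam xs [::].
    move=> v.
    have [K hK] := monX_bdd xs.
    have cF : continuous (fun x : sys_space N S => monX xs (ext x)).
      exact: monX_continuous.
    apply: (@eq_cvgE _ _ _ _ (fun r w => monX xs (ext (sys (N := N) (X r) w)))); last first.
      exact: cvgY _ cF (ex_intro _ K (fun x => hK (ext x))).
    move=> r _; apply: eq_Rintegral => w _.
    rewrite /mon /monL big_nil mulr1.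
    by apply: (eq_monX v) => i n hn; rewrite ext_valid.
  apply: (cvg_in_law_generates (a := measure_family a)); last exact: measure_family_generates.
  move=> s; under eq_fun do rewrite prod_measure_family.
  set ls := [seq _ | _ <- _]; split.
  + by have [K [_ hK]] := monE_bdd N ls; exists K.
  + by move=> r r0; exact: (monL_measurable (hLam r r0) ls).
  + apply: (@eq_cvgE _ _ _ _ (fun r => mon (X r) (Lam r) [::] ls)); last first.
      exact: (mon_cvg_systems hX hLam cX (isT : valid N [::])).
    move=> r _; apply: eq_Rintegral => w _.
    by rewrite /mon /monX big_nil mul1r.
- have cL (ls : seq ('I_C * test R S)) : mon_cvg P X Lam [::] ls.
    have [K [_ hK]] := monE_bdd N ls.
    have cF : continuous (monL ls).
      exact: monL_continuous.
    apply: (@eq_cvgE _ _ _ _ (fun r w => monL ls (Lam r w))); last first.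
      exact: cvgY _ cF (ex_intro _ K hK).
    move=> r _; apply: eq_Rintegral => w _.
    by rewrite /mon /monX big_nil mul1r.
  apply: (cvg_in_law_generates (a := sys_family a)); last exact: sys_family_generates.
  move=> s; under eq_fun do rewrite prod_sys_family.
  set xs := [seq _ | _ <- _].
  (* The filter in [prod_sys_family] has removed the indices off the index sets. *)
  have v : valid N xs by rewrite /valid all_map filter_all.
  have E r w : monX xs (ext (sys (N := N) (X r) w)) = monX xs (cfg (X r) w).
    by apply: (eq_monX v) => i n hn; rewrite ext_valid.
  split.
  + by have [K hK] := monX_bdd xs; exists K => x; exact: hK.
  + move=> r r0; rewrite (_ : _ \o _ = fun w => monX xs (cfg (X r) w)); last first.
      by apply/funext => w; exact: E.
    have [sysX _] := hX r r0.
    by apply: (monX_measurable (N := N)) => // f i n; exact: tval_X_measurable.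
  + apply: (@eq_cvgE _ _ _ _ (fun r => mon (X r) (Lam r) xs [::])); last first.
      exact: (mon_cvg_measures hN hX hLam cL v).
    move=> r _; apply: eq_Rintegral => w _.
    by rewrite /mon /monL big_nil mulr1 E.
Qed.
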